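(* Consider the cooperative pairwise-independent network (PIN) described in the context, with $M\ge 2$ relays. For $i\in\{1,\dots,M\}$ let $$I_i=\min\{I(Y_{i,A};Y_{A,i}),\,I(Y_{i,B};Y_{B,i})\},$$ and let $I_{(1)}\le I_{(2)}\le\dots\le I_{(M)}$ be these values in nondecreasing order. Then the private key capacity is $$C_K=\sum_{i=1}^M I_i-\max_{m\in\{1,\dots,M\}} I_m=\sum_{i=1}^{M-1} I_{(i)}.$$
   Context: Terminals: Alice, Bob, and relays $1,\dots,M$ ($M\ge 2$); plus a passive eavesdropper Eve. All alphabets are finite (discrete memoryless sources). For each $i\in\{1,\dots,M\}$ there are random variable pairs $(Y_{i,A},Y_{A,i})$ and $(Y_{i,B},Y_{B,i})$: Alice observes $X_A=(Y_{1,A},\dots,Y_{M,A})$, Bob observes $X_B=(Y_{1,B},\dots,Y_{M,B})$, relay $m$ observes $X_m=(Y_{A,m},Y_{B,m})$. The PIN assumption: the $2M$ pairs $(Y_{i,\alpha},Y_{\alpha,i})$, $i\in\{1,\dots,M\}$, $\alpha\in\{A,B\}$, are mutually independent (each pair $(Y_{i,\alpha},Y_{\alpha,i})$ is independent of the collection of all other pairs). Each terminal observes $n$ i.i.d. repetitions of its variable: $X_A^n, X_B^n, X_m^n$. Terminals communicate over a noiseless public channel of unlimited capacity, observed noiselessly by Eve, in $q$ rounds in round-robin order: in round $l$, relay $m$ transmits if $l\bmod (M+2)=m$, Alice if $l\bmod(M+2)=M+1$, Bob if $l\bmod(M+2)=0$; the transmitter generates $F_l\in\{1,\dots,2^{n\tilde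 R_l}\}$ according to $p(f_l\mid x^n,f^{l-1})$ where $x^n$ is its own observation and $f^{l-1}=(f_1,\dots,f_{l-1})$. After $q$ rounds, Alice computes $K_A=K_A(X_A^n,F^q)$ and Bob computes $K_B=K_B(X_B^n,F^q)$, with $F^q=(F_1,\dots,F_q)$. A rate $R$ is achievable if for every $\epsilon>0$ there exist $n$, $q$ and such a code with $\Pr(K_A\ne K_B)\le\epsilon$, $\frac1n H(K_A)\ge R-\epsilon$, $\frac1n H(K_A)\ge \frac1n\log|\mathcal K_A|-\epsilon$ (where $\mathcal K_A$ is the key alphabet), and $\frac1n I(K_A;X_m^n,F^q)\le\epsilon$ for every $m\in\{1,\dots,M\}$ (the key is secret from Eve and from each individual relay, relays non-colluding). The private key capacity $C_K$ is the supremum of achievable rates. *)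

(* Defs.v *)
From HB Require Import structures.
From mathcomp Require Import all_boot.
From Stdlib Require Import Reals List Sorting.Permutation Sorting.Sorted.
Set Implicit Arguments. Unset Strict Implicit. Unset Printing Implicit Defensive.

Local Open Scope R_scope.

Definition sumR {T : finType} (f : T -> R) : R :=
  fold_right Rplus 0 (map f (enum T)).
Definition prodR {T : finType} (f : T -> R) : R :=
  fold_right Rmult 1 (map f (enum T)).

Definition log2 (x : R) : R := ln x / ln 2.

Definition is_pmf {T : finType} (P : T -> R) : Prop :=
  (forall t, 0 <= P t) /\ sumR P = 1.

Definition prob_eq {Om : finType} (P : Om -> R) {V : eqType} (X : Om -> V) (v : V) : R :=
  sumR (fun w => if X w == v then P w else 0).
Definition entropy {Om : finType} (P : Om -> R) {V : eqType} (X : Om -> V) : R :=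
  - sumR (fun w => P w * log2 (prob_eq P X (X w))).
Definition mutinfo {Om : finType} (P : Om -> R) {V W : eqType}
    (X : Om -> V) (Y : Om -> W) : R :=
  entropy P X + entropy P Y - entropy P (fun w => (X w, Y w)).

(** PIN source.  Index k = (i, alpha) with alpha = true for Alice (A) and
    alpha = false for Bob (B).  The pair (Y_{i,alpha}, Y_{alpha,i}) takes values
    in Y i alpha * Z i alpha: the first component is observed by terminal alpha,
    the second by relay i.  The pairs are mutually independent (product pmf). *)
Section PIN.
Variables (M : nat) (Y Z : 'I_M -> bool -> finType).

Definition pairT (k : 'I_M * bool) : finType := (Y k.1 k.2 * Z k.1 k.2)%type.
Definition letter : finType := {dffun forall k : 'I_M * bool, pairT k}.

Variable p : forall i a, (Y i a * Z i a)%type -> R.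

Definition letter_pmf (x : letter) : R := prodR (fun k : 'I_M * bool => p (x k)).

Definition pair_mi (i : 'I_M) (a : bool) : R :=
  mutinfo (p (a:=a) (i:=i)) (@fst (Y i a) (Z i a)) (@snd (Y i a) (Z i a)).
Definition Imin (i : 'I_M) : R := Rmin (pair_mi i true) (pair_mi i false).

Variable n : nat.
Definition src : finType := {ffun 'I_n -> letter}.

Definition src_pmf (xs : src) : R := prodR (fun j : 'I_n => letter_pmf (xs j)).

Definition agreeA (xs xs' : src) : Prop :=
  forall (j : 'I_n) (i : 'I_M), ((xs j) (i, true)).1 = ((xs' j) (i, true)).1.
Definition agreeB (xs xs' : src) : Prop :=
  forall (j : 'I_n) (i : 'I_M), ((xs j) (i, false)).1 = ((xs' j) (i, false)).1.
Definition agreeR (i : 'I_M) (xs xs' : src) : Prop :=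
  forall (j : 'I_n) (a : bool), ((xs j) (i, a)).2 = ((xs' j) (i, a)).2.

Definition relay_obs (m : 'I_M) (xs : src) : {ffun 'I_n -> (Z m true * Z m false)%type} :=
  [ffun j => (((xs j) (m, true)).2, ((xs j) (m, false)).2)].

(** Round-robin: round r (1-based) is sent by relay t if t = r mod (M+2) is in
    1..M, by Alice if t = M+1, by Bob if t = 0.  [transmitter_agree l] says that
    xs, xs' look the same to the transmitter of 0-based round l (round r = l+1). *)
Definition transmitter_agree (l : nat) (xs xs' : src) : Prop :=
  let t := ((l.+1) %% (M.+2))%N in
  if t == O then agreeB xs xs'
  else if t == M.+1 then agreeA xs xs'
  else forall i : 'I_M, nat_of_ord i = t.-1 -> agreeR i xs xs'.

(** A code: q rounds, public messages with (padded) common finite alphabet 'I_K,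
    stochastic encoders p(f_l | x^n, f^{l-1}), keys with alphabet 'I_Ka. *)
Record code (q K Ka : nat) := Code {
  enc : 'I_q -> src -> list 'I_K -> 'I_K -> R;
  keyA : src -> q.-tuple 'I_K -> 'I_Ka;
  keyB : src -> q.-tuple 'I_K -> 'I_Ka
}.

Definition valid_code q K Ka (c : code q K Ka) : Prop :=
  (forall l xs pre f, 0 <= enc c l xs pre f) /\
  (forall l xs pre, sumR (fun f => enc c l xs pre f) = 1) /\
  (forall (l : 'I_q) xs xs' pre f,
      transmitter_agree l xs xs' -> enc c l xs pre f = enc c l xs' pre f) /\
  (forall xs xs' fs, agreeA xs xs' -> keyA c xs fs = keyA c xs' fs) /\
  (forall xs xs' fs, agreeB xs xs' -> keyB c xs fs = keyB c xs' fs).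

Definition Omega q K : finType := (src * q.-tuple 'I_K)%type.

Definition joint_pmf q K Ka (c : code q K Ka) (w : Omega q K) : R :=
  src_pmf w.1 *
  prodR (fun l : 'I_q => enc c l w.1 (take l w.2) (tnth w.2 l)).

End PIN.

Arguments letter : clear implicits.

Definition achievable (M : nat) (Y Z : 'I_M -> bool -> finType)
    (p : forall i a, (Y i a * Z i a)%type -> R) (Rate : R) : Prop :=
  forall eps : R, 0 < eps ->
  exists (n q K Ka : nat) (c : code Y Z n q K Ka),
    (0 < n)%nat /\ valid_code c /\
    let P := joint_pmf p c in
    let KA := fun w : Omega Y Z n q K => keyA c w.1 w.2 in
    let KB := fun w : Omega Y Z n q K => keyB c w.1 w.2 in
    sumR (fun w => if KA w != KB w then P w else 0) <= eps /\
    entropy P KA / INR n >= Rate - eps /\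
    entropy P KA / INR n >= log2 (INR Ka) / INR n - eps /\
    (forall m : 'I_M,
       mutinfo P KA (fun w : Omega Y Z n q K => (relay_obs m w.1, w.2)) / INR n <= eps).

Definition is_private_key_capacity (M : nat) (Y Z : 'I_M -> bool -> finType)
    (p : forall i a, (Y i a * Z i a)%type -> R) (C : R) : Prop :=
  is_lub (achievable p) C.

(* Main.v *)
(** Converse.  Give relay [m0] to Eve and every other relay to Alice or to Bob, so
    that only its weaker link crosses the cut.  Conditionally on the source of [m0]
    and on the transcript, the mutual information between the two sides starts at
    [n] times the sum of the [I_i], [i <> m0], by independence of the pairs, and
    never increases from one round to the next.  By Fano's inequality and secrecy
    against [m0] it bounds the entropy of the key.

    Achievability.  Relay [i] bins each of its two sources so finely that the bin
    together with the neighbour's observation reveals the source, and extracts from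
    each a key of rate [I_i] such that bin and key together reveal the source.  It
    publishes the two bins and the sum of the two keys, after which Alice and Bob
    share [T_i], which relay [i] knows.  The final key consists of the sums
    [T_i + T_m0], [i <> m0]; its rate is optimal when [I_m0] is the maximum.
    Secrecy is a counting argument: the key, the view of relay [m] and the quotient
    of [T_m0] by the size of [T_m] determine all the relay sources, and their joint
    entropy leaves no room for the key to depend on that view. *)
Require Import Defs.
From HB Require Import structures.
From mathcomp Require Import all_boot.
From Stdlib Require Import Reals List Sorting.Permutation Sorting.Sorted Lra.
From mathcomp Require Import zify.

Set Implicit Arguments. Unset Strict Implicit. Unset Printing Implicit Defensive.
Local Open Scope R_scope.

(** The secrecy count for relay [m], per source letter and up to vanishing terms, with H_iA and H_iB
    the entropies of the two sources of relay [i]: the sources of the relays i <> m have entropy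
    H_iA + H_iB each, while their messages take at most H_iA + H_iB - I_i each. Given the view of
    [m], the sources thus retain the sum of the I_i, i <> m. The quotient accounts for I_m0 - I_m of
    it, so the key retains the sum of all I_i minus I_m0, which is the logarithm of its alphabet.
    Near uniformity and secrecy come out together, and no pairwise key is ever shown to be uniform
    or secret by itself. The quotient arises because coordinate [i] of the key is a sum modulo
    [L i], so that [T_m0] enters only through a residue when [L i] is smaller than [L m0]. Both
    links of a relay are coded at the rate I_i of the weaker one: on the stronger link the binning
    is finer than decoding requires, so that bin and key still exhaust the source. *)

HB.instance Definition _ := Monoid.isComLaw.Build R 0 Rplus
  (fun x y z => esym (Rplus_assoc x y z)) Rplus_comm Rplus_0_l.
HB.instance Definition _ := Monoid.isComLaw.Build R 1 Rmult
  (fun x y z => esym (Rmult_assoc x y z)) Rmult_comm Rmult_1_l.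
HB.instance Definition _ := Monoid.isMulLaw.Build R 0 Rmult Rmult_0_l Rmult_0_r.
HB.instance Definition _ := Monoid.isAddLaw.Build R Rmult Rplus
  Rmult_plus_distr_r Rmult_plus_distr_l.

Local Notation "\rsum_ ( i <- r ) F" := (\big[Rplus/0]_(i <- r) F)
  (at level 41, F at level 41, i, r at level 50).
Local Notation "\rsum_ ( i <- r | P ) F" := (\big[Rplus/0]_(i <- r | P) F)
  (at level 41, F at level 41, i, r at level 50).
Local Notation "\rsum_ ( i | P ) F" := (\big[Rplus/0]_(i | P%B) F)
  (at level 41, F at level 41, i at level 50).
Local Notation "\rsum_ ( i : T ) F" := (\big[Rplus/0]_(i : T) F)
  (at level 41, F at level 41, i at level 50).
Local Notation "\rsum_ i F" := (\big[Rplus/0]_i F)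
  (at level 41, F at level 41, i at level 0).
Local Notation "\rprod_ i F" := (\big[Rmult/1]_i F)
  (at level 36, F at level 36, i at level 0).

(** * Finite sums and products of reals, binary logarithms *)

Lemma sumRE (T : finType) (f : T -> R) : sumR f = \rsum_t f t.
Proof.
rewrite /sumR -big_enum /=.
by elim: (enum T) => [|a s IH]; rewrite ?big_nil ?big_cons //= IH.
Qed.

Lemma prodRE (T : finType) (f : T -> R) : prodR f = \rprod_t f t.
Proof.
rewrite /prodR -big_enum /=.
by elim: (enum T) => [|a s IH]; rewrite ?big_nil ?big_cons //= IH.
Qed.

Lemma sumR_ext (T : finType) (f g : T -> R) : (forall t, f t = g t) -> sumR f = sumR g.
Proof. by move=> fg; rewrite !sumRE; apply: eq_bigr. Qed.

Lemma rsum_ge0 (I : Type) (r : list I) (P : pred I) (F : I -> R) :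
  (forall i, P i -> 0 <= F i) -> 0 <= \rsum_(i <- r | P i) F i.
Proof.
by move=> F0; apply: (big_ind (fun x => 0 <= x)) => // [|x y]; lra.
Qed.

Lemma rprod_ge0 (I : finType) (F : I -> R) :
  (forall i, 0 <= F i) -> 0 <= \rprod_i F i.
Proof.
move=> F0; apply: (big_ind (fun x => 0 <= x)) => // [|x y]; first lra.
exact: Rmult_le_pos.
Qed.

Lemma rprod_gt0P (I : finType) (F : I -> R) :
  (forall i, 0 <= F i) -> 0 < \rprod_i F i -> forall i, 0 < F i.
Proof.
move=> F0 + i; rewrite (bigD1 i) //=.
have [//|Fi] : 0 < F i \/ F i = 0 by have := F0 i; lra.
by rewrite Fi; lra.
Qed.

Lemma rsum_le (I : Type) (r : list I) (P : pred I) (F G : I -> R) :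
  (forall i, P i -> F i <= G i) ->
  \rsum_(i <- r | P i) F i <= \rsum_(i <- r | P i) G i.
Proof.
move=> FG; apply: (big_ind2 (fun x y => x <= y)) => // [|x y z t]; lra.
Qed.

Lemma rsumN (I : Type) (r : list I) (P : pred I) (F : I -> R) :
  \rsum_(i <- r | P i) - F i = - \rsum_(i <- r | P i) F i.
Proof.
by apply/esym; apply: (big_morph Ropp); [exact: Ropp_plus_distr|exact: Ropp_0].
Qed.

Lemma rsum_const_seq (I : Type) (r : list I) (c : R) :
  \rsum_(i <- r) c = INR (size r) * c.
Proof.
elim: r => [|a r IH]; rewrite ?big_nil ?big_cons; first by rewrite /= Rmult_0_l.
by rewrite IH [size _]/= S_INR Rmult_plus_distr_r Rmult_1_l Rplus_comm.
Qed.

Lemma rsum_const (I : finType) (c : R) : \rsum_(i : I) c = INR #|I| * c.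
Proof. by rewrite -big_enum /= rsum_const_seq -cardE. Qed.

Lemma rprod_const (I : finType) (c : R) : \big[Rmult/1]_(i : I) c = pow c #|I|.
Proof.
rewrite -big_enum /= cardE; elim: (enum I) => [|a r IH]; rewrite ?big_nil ?big_cons //.
by rewrite IH.
Qed.

Lemma rsum_pred_le (I : finType) (P Q : pred I) (F : I -> R) :
  (forall i, 0 <= F i) -> (forall i, P i -> Q i) ->
  \rsum_(i | P i) F i <= \rsum_(i | Q i) F i.
Proof.
move=> F0 PQ; rewrite (big_mkcond P) (big_mkcond Q); apply: rsum_le => i _.
by case: (P i) (PQ i) (F0 i) => [-> //|_]; case: (Q i) => //; lra.
Qed.

Lemma rsum_ge_term (I : finType) (P : pred I) (F : I -> R) (i : I) :
  (forall i, 0 <= F i) -> P i -> F i <= \rsum_(i | P i) F i.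
Proof.
move=> F0 Pi; rewrite (bigD1 i) //=.
have := @rsum_ge0 _ (index_enum I) (fun j => P j && (j != i)) F (fun j _ => F0 j); lra.
Qed.

Lemma rsum_pick (I : finType) (i : I) (F : I -> R) :
  \rsum_j (if j == i then F j else 0) = F i.
Proof. by rewrite -big_mkcond big_pred1_eq. Qed.

Lemma ln2_gt0 : 0 < ln 2. Proof. by rewrite -ln_1; apply: ln_increasing; lra. Qed.

Lemma log2_1 : log2 1 = 0. Proof. by rewrite /log2 ln_1 /Rdiv Rmult_0_l. Qed.

Lemma log2_2 : log2 2 = 1.
Proof. by rewrite /log2; apply: Rinv_r; have := ln2_gt0; lra. Qed.

Lemma log2M x y : 0 < x -> 0 < y -> log2 (x * y) = log2 x + log2 y.
Proof. by move=> x0 y0; rewrite /log2 ln_mult //; field; have := ln2_gt0; lra. Qed.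

Lemma log2V x : 0 < x -> log2 (/ x) = - log2 x.
Proof. by move=> x0; rewrite /log2 ln_Rinv //; field; have := ln2_gt0; lra. Qed.

Lemma log2_div x y : 0 < x -> 0 < y -> log2 (x / y) = log2 x - log2 y.
Proof.
by move=> x0 y0; rewrite /Rdiv log2M ?log2V //; apply: Rinv_0_lt_compat.
Qed.

Lemma log2_le x y : 0 < x -> x <= y -> log2 x <= log2 y.
Proof.
move=> x0 [xy|<-]; last lra.
apply: Rmult_le_compat_r; first by left; apply: Rinv_0_lt_compat; exact: ln2_gt0.
by left; apply: ln_increasing.
Qed.

Lemma ln_le_sub1 x : 0 < x -> ln x <= x - 1.
Proof.
by move=> x0; have := exp_ineq1_le (ln x); rewrite exp_ln //; lra.
Qed.

Lemma log2_le_sub1 x : 0 < x -> log2 x <= (x - 1) / ln 2.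
Proof.
move=> x0; apply: Rmult_le_compat_r; last exact: ln_le_sub1.
by left; apply: Rinv_0_lt_compat; exact: ln2_gt0.
Qed.

Lemma log2_Rpower x : log2 (Rpower 2 x) = x.
Proof. by rewrite /log2 /Rpower ln_exp; field; have := ln2_gt0; lra. Qed.

Lemma Rpower_log2 x : 0 < x -> Rpower 2 (log2 x) = x.
Proof.
move=> x0; rewrite /log2 /Rpower.
have -> : ln x / ln 2 * ln 2 = ln x by field; have := ln2_gt0; lra.
exact: exp_ln.
Qed.

Lemma log2_prod (I : finType) (F : I -> R) :
  (forall i, 0 < F i) -> log2 (\rprod_i F i) = \rsum_i log2 (F i).
Proof.
move=> F0.
suff: 0 < \rprod_i F i /\ log2 (\rprod_i F i) = \rsum_i log2 (F i) by case.
apply: (big_ind2 (fun x y => 0 < x /\ log2 x = y)) => [|x1 x2 y1 y2 [? <-] [? <-]|i _].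
- by split; [lra|exact: log2_1].
- by split; [exact: Rmult_lt_0_compat|rewrite log2M].
- by split.
Qed.

(** * Entropy inequalities *)

Section Entropy.
Variables (Om : finType) (P : Om -> R).
Hypothesis Ppmf : is_pmf P.

Let P0 w : 0 <= P w. Proof. by case: Ppmf. Qed.

Lemma pmf_sum1 : \rsum_w P w = 1.
Proof. by case: Ppmf => _; rewrite sumRE. Qed.

Lemma prob_eqE (V : eqType) (X : Om -> V) v : prob_eq P X v = \rsum_(w | X w == v) P w.
Proof. by rewrite /prob_eq sumRE [RHS]big_mkcond. Qed.

Lemma prob_eq_ge0 (V : eqType) (X : Om -> V) v : 0 <= prob_eq P X v.
Proof. by rewrite prob_eqE; apply: rsum_ge0. Qed.

Lemma prob_eq_ge (V : eqType) (X : Om -> V) w : P w <= prob_eq P X (X w).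
Proof. by rewrite prob_eqE; apply: rsum_ge_term. Qed.

Lemma sum_prob_eq (V : finType) (X : Om -> V) : \rsum_v prob_eq P X v = 1.
Proof.
rewrite -pmf_sum1 (partition_big X predT) //=.
by apply: eq_bigr => v _; rewrite prob_eqE.
Qed.

Lemma entropyE (V : eqType) (X : Om -> V) :
  entropy P X = - \rsum_w P w * log2 (prob_eq P X (X w)).
Proof. by rewrite /entropy sumRE. Qed.

(** Entropy sees only the partition into fibres. This is how tuples are rebracketed, and components
    determined by the others dropped or added, in all that follows. *)
Lemma entropy_ker (V W : eqType) (X : Om -> V) (Y : Om -> W) :
  (forall w w', (X w == X w') = (Y w == Y w')) -> entropy P X = entropy P Y.
Proof.
move=> XY; rewrite !entropyE; congr (- _); apply: eq_bigr => w _; congr (_ * log2 _).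
by rewrite !prob_eqE; apply: eq_bigl => w'; rewrite XY.
Qed.

Lemma entropy_le_ref (V W : eqType) (X : Om -> V) (Y : Om -> W) :
  (forall w w', X w = X w' -> Y w = Y w') -> entropy P Y <= entropy P X.
Proof.
move=> XY; rewrite !entropyE; apply: Ropp_le_contravar; apply: rsum_le => w _.
case: (P0 w) => [Pw|<-]; last lra.
apply: Rmult_le_compat_l => //; apply: log2_le.
  by apply: Rlt_le_trans Pw _; exact: prob_eq_ge.
by rewrite !prob_eqE; apply: rsum_pred_le => // w' /eqP /XY ->.
Qed.

Lemma entropy_cst (V : eqType) (c : V) : entropy P (fun=> c) = 0.
Proof.
rewrite entropyE big1 ?Ropp_0 // => w _.
have -> : prob_eq P (fun=> c) c = 1; last by rewrite log2_1 Rmult_0_r.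
by rewrite prob_eqE -pmf_sum1; apply: eq_bigl => w'; rewrite eqxx.
Qed.

(* Gibbs' inequality, conditionally on [B]; the inequalities below are choices of [q]. *)
Lemma cross_entropy (VA : finType) (VB : eqType) (A : Om -> VA) (B : Om -> VB)
    (q : VA -> VB -> R) :
  (forall a b, 0 <= q a b) -> (forall b, \rsum_a q a b <= 1) ->
  (forall w, 0 < P w -> 0 < q (A w) (B w)) ->
  entropy P (fun w => (A w, B w)) <= entropy P B - \rsum_w P w * log2 (q (A w) (B w)).
Proof.
move=> q0 q1 qpos.
pose AB w := (A w, B w).
pose pA w := prob_eq P AB (AB w); pose pB w := prob_eq P B (B w).
have pA_gt w : 0 < P w -> 0 < pA w by move=> ?; have := prob_eq_ge AB w; rewrite -/(pA w); lra.
have pB_gt w : 0 < P w -> 0 < pB w by move=> ?; have := prob_eq_ge B w; rewrite -/(pB w); lra.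
pose Q w := q (A w) (B w) * pB w / pA w.
(* Writing [pB] as a sum over [w2] regroups the expectation by fibres of [B]. Within one of them,
   the fibre of [A] over [a] contributes at most [q a b], since [pA] cancels its mass. *)
have sumQ : \rsum_w P w * Q w <= 1.
  have -> : \rsum_w P w * Q w =
      \rsum_w2 \rsum_(w | B w == B w2) P w2 * (P w * (q (A w) (B w) / pA w)).
    under [RHS]eq_bigr => w2 _ do rewrite big_mkcond /=.
    rewrite exchange_big /=; apply: eq_bigr => w _.
    rewrite -big_mkcond /= -big_distrl /=.
    have -> : \rsum_(i | B w == B i) P i = pB w.
      by rewrite /pB prob_eqE; apply: eq_bigl => w'; rewrite eq_sym.
    by rewrite /Q /Rdiv; ring.
  rewrite -pmf_sum1; apply: rsum_le => w2 _.
  rewrite -big_distrr /= -{2}[P w2]Rmult_1_r; apply: Rmult_le_compat_l => //.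
  apply: Rle_trans (q1 (B w2)).
  rewrite (partition_big A predT) //=; apply: rsum_le => a _.
  have [w0 /andP[/eqP Bw0 /eqP Aw0]|none] := pickP (fun w => (B w == B w2) && (A w == a)); last first.
    by rewrite big_pred0.
  have pAE w : (B w == B w2) && (A w == a) -> pA w = pA w0.
    by move=> /andP[/eqP Bw /eqP Aw]; rewrite /pA /AB Aw Bw Bw0 Aw0.
  rewrite (eq_bigr (fun w => P w * (q a (B w2) / pA w0))); last first.
    by move=> w cw; rewrite pAE //; case/andP: cw => /eqP -> /eqP ->.
  rewrite -big_distrl /=.
  have -> : \rsum_(i | (B i == B w2) && (A i == a)) P i = pA w0.
    rewrite /pA prob_eqE; apply: eq_bigl => w; rewrite /AB xpair_eqE Bw0 Aw0.
    by rewrite andbC.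
  case: (Req_dec (pA w0) 0) => [->|nz]; last by right; field.
  by rewrite Rmult_0_l; exact: q0.
have gibbs : \rsum_w P w * log2 (Q w) <= 0.
  apply: (@Rle_trans _ (\rsum_w (P w * Q w - P w) / ln 2)).
    apply: rsum_le => w _; case: (P0 w) => [Pw|<-]; last by rewrite /Rdiv; lra.
    have Qw : 0 < Q w.
      apply: Rmult_lt_0_compat; last by apply: Rinv_0_lt_compat; exact: pA_gt.
      by apply: Rmult_lt_0_compat; [exact: qpos|exact: pB_gt].
    have -> : (P w * Q w - P w) / ln 2 = P w * ((Q w - 1) / ln 2).
      by field; have := ln2_gt0; lra.
    by apply: Rmult_le_compat_l => //; exact: log2_le_sub1.
  rewrite /Rdiv -big_distrl /= /Rminus big_split /= rsumN pmf_sum1.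
  apply: (@Rle_trans _ ((1 + - 1) * / ln 2)); last lra.
  apply: Rmult_le_compat_r; last exact: Rplus_le_compat_r.
  by left; apply: Rinv_0_lt_compat; exact: ln2_gt0.
suff E : \rsum_w P w * log2 (Q w) = \rsum_w P w * log2 (q (A w) (B w))
    + \rsum_w P w * log2 (pB w) - \rsum_w P w * log2 (pA w).
  have -> : entropy P (fun w => (A w, B w)) = - \rsum_w P w * log2 (pA w) by exact: entropyE.
  have -> : entropy P B = - \rsum_w P w * log2 (pB w) by exact: entropyE.
  by rewrite E in gibbs; lra.
rewrite /Rminus -rsumN -!big_split /=; apply: eq_bigr => w _.
case: (P0 w) => [Pw|<-]; last lra.
have ? := qpos w Pw; have ? := pA_gt w Pw; have ? := pB_gt w Pw.
by rewrite /Q log2_div ?log2M //; [ring|exact: Rmult_lt_0_compat].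
Qed.

(** Nonnegativity of I(A; B | C): Gibbs' inequality given (B, C), with the conditional law of [A]
    given [C] alone as reference. *)
Lemma entropy_submod (VA : finType) (VB VC : eqType)
    (A : Om -> VA) (B : Om -> VB) (C : Om -> VC) :
  entropy P (fun w => (A w, (B w, C w))) + entropy P C <=
  entropy P (fun w => (A w, C w)) + entropy P (fun w => (B w, C w)).
Proof.
pose q a (bc : VB * VC) := prob_eq P (fun w => (A w, C w)) (a, bc.2) / prob_eq P C bc.2.
have marg c : \rsum_a prob_eq P (fun w => (A w, C w)) (a, c) = prob_eq P C c.
  rewrite [RHS]prob_eqE (partition_big A predT) //=; apply: eq_bigr => a _.
  by rewrite prob_eqE; apply: eq_bigl => w; rewrite xpair_eqE andbC.
have cpos w : 0 < P w -> 0 < prob_eq P C (C w) by move=> ?; have := prob_eq_ge C w; lra.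
have acpos w : 0 < P w -> 0 < prob_eq P (fun w => (A w, C w)) (A w, C w).
  by move=> ?; have := prob_eq_ge (fun w => (A w, C w)) w; lra.
have q_ge0 a bc : 0 <= q a bc.
  rewrite /q /Rdiv; apply: Rmult_le_pos; first exact: prob_eq_ge0.
  case: (prob_eq_ge0 C bc.2) => [?|<-]; first by left; apply: Rinv_0_lt_compat.
  by rewrite Rinv_0; lra.
have q_sum bc : \rsum_a q a bc <= 1.
  rewrite /q /= -big_distrl /= marg.
  case: (Req_dec (prob_eq P C bc.2) 0) => [->|nz]; first by rewrite Rmult_0_l; lra.
  by right; apply: Rinv_r.
have q_gt0 w : 0 < P w -> 0 < q (A w) (B w, C w).
  move=> Pw; rewrite /q /=; apply: Rmult_lt_0_compat; first exact: acpos.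
  by apply: Rinv_0_lt_compat; exact: cpos.
have := @cross_entropy VA _ A (fun w => (B w, C w)) q q_ge0 q_sum q_gt0.
suff -> : \rsum_w P w * log2 (q (A w) (B w, C w)) =
  \rsum_w P w * log2 (prob_eq P (fun w => (A w, C w)) (A w, C w))
  - \rsum_w P w * log2 (prob_eq P C (C w)) by rewrite !entropyE; lra.
rewrite /Rminus -rsumN -!big_split /=; apply: eq_bigr => w _.
case: (P0 w) => [Pw|<-]; last lra.
by rewrite /q /= log2_div; [ring|exact: acpos|exact: cpos].
Qed.

Lemma entropy_pair_le (VA : finType) (VB : eqType) (A : Om -> VA) (B : Om -> VB) :
  entropy P (fun w => (A w, B w)) <= entropy P A + entropy P B.
Proof.
have := entropy_submod A B (fun=> tt); rewrite entropy_cst.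
rewrite (@entropy_ker _ _ (fun w => (A w, (B w, tt))) (fun w => (A w, B w))); last first.
  by move=> w w'; rewrite !xpair_eqE eqxx andbT.
rewrite (@entropy_ker _ _ (fun w => (A w, tt)) A); last first.
  by move=> w w'; rewrite !xpair_eqE eqxx andbT.
rewrite (@entropy_ker _ _ (fun w => (B w, tt)) B); last first.
  by move=> w w'; rewrite !xpair_eqE eqxx andbT.
lra.
Qed.

Lemma pmf_inhabited : exists w : Om, true.
Proof.
have [w _|none] := pickP (@predT Om); first by exists w.
have := pmf_sum1; rewrite big_pred0 //; lra.
Qed.

Lemma card_gt0_of (V : finType) (v : V) : 0 < INR #|V|.
Proof. by apply: lt_0_INR; apply/ltP/card_gt0P; exists v. Qed.

Lemma entropy_pair_card (VA : finType) (VB : eqType) (A : Om -> VA) (B : Om -> VB) :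
  entropy P (fun w => (A w, B w)) <= entropy P B + log2 (INR #|VA|).
Proof.
have [w0 _] := pmf_inhabited; have c0 := card_gt0_of (A w0).
have := @cross_entropy VA _ A B (fun _ _ => / INR #|VA|).
have q0 : 0 < / INR #|VA| by apply: Rinv_0_lt_compat.
rewrite -big_distrl /= pmf_sum1 Rmult_1_l log2V //.
move=> H; have := H (fun _ _ => Rlt_le _ _ q0) _ (fun _ _ => q0).
rewrite rsum_const Rinv_r; last lra.
by move=> H1; have := H1 (fun=> Rle_refl _); lra.
Qed.

Lemma entropy_card (VA : finType) (A : Om -> VA) : entropy P A <= log2 (INR #|VA|).
Proof.
have := entropy_pair_card A (fun=> tt); rewrite entropy_cst.
rewrite (@entropy_ker _ _ (fun w => (A w, tt)) A); first lra.
by move=> w w'; rewrite xpair_eqE eqxx andbT.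
Qed.

(** Slightly more than the binary entropy of [eta]: the first logarithm has weight 1 instead of
    [1 - eta], because [eta] only bounds the error from above and the good event may have any mass
    up to 1. *)
Definition fano_bound (eta : R) : R := - log2 (1 - eta) - eta * log2 eta.

(* Fano's inequality.  The decoder is implicit: [B] determines [A] on the good event [G]. *)
Lemma fano (VA : finType) (VB : eqType) (A : Om -> VA) (B : Om -> VB) (G : pred Om) eta :
  0 < eta < 1 -> \rsum_(w | ~~ G w) P w <= eta ->
  (forall w w', G w -> G w' -> B w = B w' -> A w = A w') ->
  entropy P (fun w => (A w, B w)) <=
    entropy P B + fano_bound eta + eta * log2 (INR #|VA|).
Proof.
move=> eta01 bad inj; have [w0 _] := pmf_inhabited; have c0 := card_gt0_of (A w0).
pose dec b := oapp A (A w0) [pick w | G w & B w == b].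
have decE w : G w -> dec (B w) = A w.
  move=> Gw; rewrite /dec; case: pickP => [w' /andP[Gw' /eqP eB]|/(_ w)] /=.
    exact: inj.
  by rewrite Gw eqxx.
pose N := INR #|VA|.
(* Mixture of the decoder's guess and the uniform law; the uniform part keeps [q] positive where the
   decoder is wrong. *)
pose q a b := (if a == dec b then 1 - eta else 0) + eta / N.
have etaN : 0 < eta / N by apply: Rmult_lt_0_compat; [lra|apply: Rinv_0_lt_compat].
have qge a b : eta / N <= q a b by rewrite /q; case: ifP => _; lra.
have qgood w : G w -> 1 - eta <= q (A w) (B w).
  by move=> Gw; rewrite /q decE // eqxx; lra.
have q_ge0 a b : 0 <= q a b by have := qge a b; lra.
have q_sum b : \rsum_a q a b <= 1.
  rewrite /q big_split /= rsum_pick rsum_const -/N.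
  have -> : N * (eta / N) = eta by field; rewrite /N; lra.
  by lra.
have q_gt0 w : 0 < P w -> 0 < q (A w) (B w) by have := qge (A w) (B w); lra.
apply: Rle_trans (cross_entropy q_ge0 q_sum q_gt0) _; rewrite -/N.
have N1 : 1 <= N.
  rewrite /N -[1]/(INR 1); apply: le_INR; apply/leP/card_gt0P; by exists (A w0).
have le1 x : 0 < x <= 1 -> log2 x <= 0 by move=> ?; rewrite -log2_1; apply: log2_le; lra.
have l1 : log2 (1 - eta) <= 0 by apply: le1; lra.
have l2 : log2 (eta / N) <= 0.
  apply: le1; split=> //; apply: (Rmult_le_reg_r N); first by rewrite /N.
  have -> : eta / N * N = eta by field; rewrite /N; lra.
  by lra.
have h1 : log2 (1 - eta) <= \rsum_(w | G w) P w * log2 (q (A w) (B w)).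
  apply: (@Rle_trans _ (\rsum_(w | G w) P w * log2 (1 - eta))).
    rewrite -big_distrl /=.
    have : \rsum_(w | G w) P w <= 1 by rewrite -pmf_sum1; apply: rsum_pred_le.
    have := @rsum_ge0 _ (index_enum Om) G P (fun w _ => P0 w); nra.
  apply: rsum_le => w Gw; apply: Rmult_le_compat_l => //.
  by apply: log2_le; [lra|exact: qgood].
have h2 : eta * log2 (eta / N) <= \rsum_(w | ~~ G w) P w * log2 (q (A w) (B w)).
  apply: (@Rle_trans _ (\rsum_(w | ~~ G w) P w * log2 (eta / N))).
    rewrite -big_distrl /=.
    have := @rsum_ge0 _ (index_enum Om) (fun w => ~~ G w) P (fun w _ => P0 w); nra.
  by apply: rsum_le => w Gw; apply: Rmult_le_compat_l => //; apply: log2_le.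
rewrite (bigID G) /=.
move: h2; rewrite log2_div /fano_bound; try lra; rewrite /N; lra.
Qed.

End Entropy.

(** * Product laws *)

(** [fprod] embeds dependent functions into functions with tagged values, for which products
    distribute over sums. *)
Lemma dffun_distr (I : finType) (T : I -> finType) (F : forall i, T i -> R) :
  \rsum_(x : {dffun forall i, T i}) \rprod_i F i (x i) = \rprod_i \rsum_t F i t.
Proof.
rewrite (reindex (@dffun_of_fprod I T)) /=; last exact/onW_bij/dffun_of_fprod_bij.
pose P_ i : {ffun T i -> R} := [ffun t => F i t].
transitivity (\big[Rplus/0]_(t : fprod T) \rprod_i P_ i (t i)).
  by apply: eq_bigr => t _; apply: eq_bigr => i _; rewrite !ffunE.
rewrite (@big_fprod R 0 1 Rmult Rplus I T P_).
rewrite -(@bigA_distr_big_dep R 0 1 Rmult Rplus I _ (tagged_with T) (fun i j => untag 0 (P_ i) j)).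
apply: eq_bigr => i _; rewrite -(@big_tag R 0 Rplus I T P_ i).
by apply: eq_bigr => t _; rewrite ffunE.
Qed.

Section ProductLaw.
Variables (I : finType) (T : I -> finType) (p : forall i, T i -> R).
Hypothesis p_pmf : forall i, is_pmf (@p i).

Definition prod_law (x : {dffun forall i, T i}) : R := \rprod_i p (x i).

Lemma prod_law_pmf : is_pmf prod_law.
Proof.
split=> [x|]; first by apply: rprod_ge0 => i; case: (p_pmf i).
by rewrite sumRE dffun_distr big1 // => i _; apply: pmf_sum1.
Qed.

(** Absorbing [psi] into factor [i] keeps the product form; each other factor then sums to one. *)
Lemma prod_law_marginal i (psi : T i -> R) :
  \rsum_x prod_law x * psi (x i) = \rsum_t p t * psi t.
Proof.
pose F := @dfwith I (fun j => T j -> R) p i (fun t => p t * psi t).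
transitivity (\rsum_(x : {dffun forall i, T i}) \rprod_j F j (x j)).
  apply: eq_bigr => x _; rewrite /prod_law (bigD1 i) //= [RHS](bigD1 i) //=.
  have -> : \big[Rmult/1]_(j | j != i) F j (x j) = \big[Rmult/1]_(j | j != i) p (x j).
    by apply: eq_bigr => j ji; rewrite /F dfwith_out // eq_sym.
  by rewrite /F dfwith_in; lra.
rewrite dffun_distr (bigD1 i) //= /F dfwith_in -[RHS]Rmult_1_r; congr (_ * _).
by apply: big1 => j ji; rewrite dfwith_out 1?eq_sym //; apply: pmf_sum1.
Qed.

Lemma prod_law_agree (e : forall i, T i -> bool) :
  \big[Rplus/0]_(x : {dffun forall i, T i} | [forall i, e i (x i)]) prod_law x
  = \rprod_i \rsum_(t | e i t) p t.
Proof.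
rewrite big_mkcond /=.
transitivity (\rsum_(x : {dffun forall i, T i}) \rprod_i (if e i (x i) then p (x i) else 0)).
  apply: eq_bigr => x _; case: forallP => [ex|nex].
    by apply: eq_bigr => i _; rewrite ex.
  have [i ei] : exists i, ~~ e i (x i).
    by apply/existsP; apply: contra_notT nex => /existsPn nex i; exact: negbNE.
  by rewrite (bigD1 i) //= (negbTE ei) Rmult_0_l.
rewrite (@dffun_distr I T (fun i t => if e i t then p t else 0)).
by apply: eq_bigr => i _; rewrite [RHS]big_mkcond.
Qed.

Lemma prod_law_gt0 x i : 0 < prod_law x -> 0 < p (x i).
Proof. by move=> x0; apply: (rprod_gt0P _ x0) => j; case: (p_pmf j). Qed.

(* [X] observes each coordinate [i] through [f i]. *)
Lemma prob_eq_prod_law (V : eqType) (W : I -> eqType) (f : forall i, T i -> W i)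
    (X : {dffun forall i, T i} -> V) :
  (forall x x', (X x == X x') = [forall i, f i (x i) == f i (x' i)]) ->
  forall x, prob_eq prod_law X (X x) = \rprod_i prob_eq (@p i) (f i) (f i (x i)).
Proof.
move=> Xf x; rewrite prob_eqE.
rewrite (eq_bigl (fun x' : {dffun forall i, T i} => [forall i, f i (x' i) == f i (x i)])).
  rewrite (prod_law_agree (fun i t => f i t == f i (x i))); apply: eq_bigr => i _; by rewrite prob_eqE.
by move=> x'; rewrite Xf.
Qed.

(** On the support the logarithm of the product splits, and each summand depends on one coordinate
    only, so it is averaged under the law of that coordinate. *)
Lemma entropy_prod_law (V : eqType) (W : I -> eqType) (f : forall i, T i -> W i)
    (X : {dffun forall i, T i} -> V) :
  (forall x x', (X x == X x') = [forall i, f i (x i) == f i (x' i)]) ->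
  entropy prod_law X = \rsum_i entropy (@p i) (f i).
Proof.
move=> Xf; rewrite entropyE.
transitivity (\rsum_i - \rsum_t p t * log2 (prob_eq (@p i) (f i) (f i t))); last first.
  by apply: eq_bigr => i _; rewrite entropyE.
rewrite rsumN; congr (- _).
transitivity (\rsum_i \rsum_x prod_law x * log2 (prob_eq (@p i) (f i) (f i (x i)))).
  rewrite exchange_big /=; apply: eq_bigr => x _; rewrite -big_distrr /=.
  have [x0|<-] := proj1 prod_law_pmf x; last by rewrite !Rmult_0_l.
  rewrite (prob_eq_prod_law Xf) log2_prod // => i.
  have := prob_eq_ge (p_pmf i) (f i) (x i); have := prod_law_gt0 i x0; lra.
apply: eq_bigr => i _.
exact: (@prod_law_marginal i (fun t => log2 (prob_eq (@p i) (f i) (f i t)))).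
Qed.

End ProductLaw.

Lemma eq_entropy (Om : finType) (P Q : Om -> R) (V : eqType) (X : Om -> V) :
  (forall w, P w = Q w) -> entropy P X = entropy Q X.
Proof.
move=> PQ; rewrite /entropy; congr (- _); apply: sumR_ext => w; rewrite PQ.
by congr (_ * log2 _); apply: sumR_ext => w'; rewrite PQ.
Qed.

Lemma eq_pmf (Om : finType) (P Q : Om -> R) :
  (forall w, P w = Q w) -> is_pmf Q -> is_pmf P.
Proof.
move=> PQ [Q0 Q1]; split=> [w|]; first by rewrite PQ.
by rewrite -Q1; apply: sumR_ext.
Qed.

(** * Image laws *)

Section Pushforward.
Variables (Om Om' : finType) (P : Om -> R) (Q : Om' -> R) (g : Om -> Om').
Hypothesis QP : forall w', Q w' = \rsum_(w | g w == w') P w.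

Lemma push_expand (F : Om' -> R) : \rsum_w P w * F (g w) = \rsum_w' Q w' * F w'.
Proof.
rewrite (partition_big g predT) //=; apply: eq_bigr => w' _.
by rewrite QP big_distrl /=; apply: eq_bigr => w /eqP ->.
Qed.

Lemma push_event (A : pred Om') : \rsum_(w | A (g w)) P w = \rsum_(w' | A w') Q w'.
Proof.
have := push_expand (fun w' => if A w' then 1 else 0).
rewrite [X in X = _ -> _](eq_bigr (fun w => if A (g w) then P w else 0)); last first.
  by move=> w _; case: ifP => _; lra.
rewrite [X in _ = X -> _](eq_bigr (fun w => if A w then Q w else 0)).
  by rewrite -!big_mkcond.
by move=> w _; case: ifP => _; lra.
Qed.

(** Serves in both directions: the source is the image of the joint space, and for deterministic
    encoders the joint law is itself an image of the source law. *)
Lemma push_entropy (V : eqType) (X : Om' -> V) :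
  entropy P (fun w => X (g w)) = entropy Q X.
Proof.
rewrite !entropyE -(push_expand (fun w' => log2 (prob_eq Q X (X w')))).
congr (- _); apply: eq_bigr => w _; congr (_ * log2 _).
by rewrite !prob_eqE (push_event (fun w' => X w' == X (g w))).
Qed.

End Pushforward.

(** * The source *)

Section Source.
Variables (M : nat) (Y Z : 'I_M -> bool -> finType).
Variable p : forall i a, (Y i a * Z i a)%type -> R.
Hypothesis hp : forall i a, is_pmf (@p i a).
Variable n : nat.

Definition pair_pmf (k : 'I_M * bool) (t : pairT Y Z k) : R := p t.

Lemma letter_pmfE x : letter_pmf p x = prod_law pair_pmf x.
Proof. by rewrite /letter_pmf prodRE. Qed.

Lemma letter_pmf_pmf : is_pmf (letter_pmf p).
Proof. by apply: eq_pmf letter_pmfE _; apply: prod_law_pmf => k; exact: hp. Qed.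

Lemma src_pmfE (xs : src Y Z n) : src_pmf p xs = prod_law (fun=> letter_pmf p) xs.
Proof. by rewrite /src_pmf prodRE. Qed.

Lemma src_pmf_pmf : is_pmf (@src_pmf M Y Z p n).
Proof. by apply: eq_pmf src_pmfE _; apply: prod_law_pmf => k; exact: letter_pmf_pmf. Qed.

(** [None] marks a hidden component, so that observations under all masks share one finite type. *)
Definition viewT (k : 'I_M * bool) : finType := (option (Y k.1 k.2) * option (Z k.1 k.2))%type.

Definition view (b : bool * bool) (k : 'I_M * bool) (t : pairT Y Z k) : viewT k :=
  (if b.1 then Some t.1 else None, if b.2 then Some t.2 else None).

Definition mask := 'I_M * bool -> bool * bool.

(* [obs m] reveals, for each pair [k], the terminal's component if [(m k).1]
   and the relay's component if [(m k).2]. *)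
Definition obs (m : mask) (xs : src Y Z n) : {ffun 'I_n -> {dffun forall k, viewT k}} :=
  [ffun j => [ffun k => view (m k) (xs j k)]].

Lemma obs_eqE (m : mask) xs xs' : (obs m xs == obs m xs') =
  [forall j, [forall k, view (m k) (xs j k) == view (m k) (xs' j k)]].
Proof.
apply/eqP/forallP => [E j|E].
  apply/forallP => k; apply/eqP.
  by move: E => /ffunP/(_ j); rewrite !ffunE => /ffunP/(_ k); rewrite !ffunE.
apply/ffunP => j; rewrite !ffunE; apply/ffunP => k; rewrite !ffunE.
by have /forallP/(_ k)/eqP := E j.
Qed.

Lemma obs_eq (m : mask) xs xs' : obs m xs = obs m xs' <->
  (forall j k, ((m k).1 -> (xs j k).1 = (xs' j k).1) /\ ((m k).2 -> (xs j k).2 = (xs' j k).2)).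
Proof.
split=> [/eqP|E].
  rewrite obs_eqE => /forallP E j k; have /forallP/(_ k)/eqP := E j.
  by case=> E1 E2; split=> mk; [move: E1|move: E2]; rewrite mk => -[].
apply/eqP; rewrite obs_eqE; apply/forallP => j; apply/forallP => k; apply/eqP.
have [] := E j k; rewrite /view; case: (m k) => -[] [] /= E1 E2.
- by rewrite E1 ?E2.
- by rewrite E1.
- by rewrite E2.
- by [].
Qed.

(** Independence enters twice: between the [n] letters, and between the pairs within a letter. *)
Lemma obs_entropy (m : mask) :
  entropy (@src_pmf M Y Z p n) (obs m) =
  INR n * \rsum_k entropy (@pair_pmf k) (@view (m k) k).
Proof.
pose row (x : letter M Y Z) : {dffun forall k, viewT k} := [ffun k => view (m k) (x k)].
rewrite (eq_entropy _ src_pmfE).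
have rowE x x' : (row x == row x') = [forall k, view (m k) (x k) == view (m k) (x' k)].
  apply/eqP/forallP => [/ffunP E k|E]; first by have := E k; rewrite !ffunE => ->.
  by apply/ffunP => k; rewrite !ffunE; apply/eqP.
rewrite (@entropy_prod_law _ (fun=> letter M Y Z) (fun=> letter_pmf p) (fun=> letter_pmf_pmf) _
  (fun=> {dffun forall k, viewT k}) (fun=> row)).
  rewrite rsum_const card_ord; congr (_ * _).
  rewrite (eq_entropy _ letter_pmfE).
  exact: (@entropy_prod_law _ _ pair_pmf (fun k => hp k.1 k.2) _ viewT (fun k => @view (m k) k)).
move=> xs xs'; rewrite obs_eqE; apply: eq_forallb => j; by rewrite rowE.
Qed.

Lemma entropy_view (b : bool * bool) k :
  entropy (@pair_pmf k) (@view b k) =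
  match b with
  | (true, true) => entropy (@p k.1 k.2) (fun t => (t.1, t.2))
  | (true, false) => entropy (@p k.1 k.2) (@fst _ _)
  | (false, true) => entropy (@p k.1 k.2) (@snd _ _)
  | (false, false) => 0
  end.
Proof.
case: b => -[] []; rewrite /view /=.
- by apply: entropy_ker => t t'; rewrite !xpair_eqE.
- by apply: entropy_ker => t t'; rewrite !xpair_eqE andbT.
- by apply: entropy_ker => t t'; rewrite !xpair_eqE.
- exact: (entropy_cst (hp k.1 k.2)).
Qed.

End Source.

(** * Transcripts *)

Section Protocol.
Variables (M : nat) (Y Z : 'I_M -> bool -> finType).
Variable p : forall i a, (Y i a * Z i a)%type -> R.
Hypothesis hp : forall i a, is_pmf (@p i a).
Variables (n q K Ka : nat) (c : code Y Z n q K Ka).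
Hypothesis hc : valid_code c.

Let enc_ge0 l xs pre f : 0 <= enc c l xs pre f. Proof. by case: hc. Qed.

Let enc_sum1 l xs pre : \rsum_f enc c l xs pre f = 1.
Proof. by case: hc => _ [h _]; rewrite -sumRE h. Qed.

Definition transcript_prob xs (fs : q.-tuple 'I_K) : R :=
  \rprod_l enc c l xs (take l fs) (tnth fs l).

Lemma joint_pmfE w : joint_pmf p c w = src_pmf p w.1 * transcript_prob w.1 w.2.
Proof. by rewrite /joint_pmf prodRE. Qed.

(** Probability, given the source, that the transcript starts with [pre]. Reading [pre] through
    [onth] needs no default message, and ['I_K] may be empty; the value 0 is never reached since
    [i < size pre]. *)
Definition prefix_prob xs (pre : list 'I_K) : R :=
  \big[Rmult/1]_(i < q | (i < size pre)%nat) oapp (enc c i xs (take i pre)) 0 (onth pre i).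

Lemma prefix_prob_rcons xs pre f (l : 'I_q) : size pre = l ->
  prefix_prob xs (rcons pre f) = prefix_prob xs pre * enc c l xs pre f.
Proof.
move=> sl; rewrite /prefix_prob (bigD1 l) /=; last by rewrite size_rcons sl.
rewrite Rmult_comm; congr (_ * _); last first.
  by rewrite -sl -{1}cats1 take_size_cat // onthE map_rcons nth_rcons size_map ltnn eqxx.
apply: eq_big => [i|i].
  rewrite size_rcons sl ltnS leq_eqVlt; case: eqP => [/val_inj ->|ne] /=.
    by rewrite eqxx ltnn.
  have -> : i != l by apply/eqP => il; apply: ne; rewrite il.
  by rewrite andbT.
rewrite size_rcons sl => /andP[il nil].
have {}il : (i < size pre)%nat.
  by rewrite sl ltn_neqAle nil -ltnS.
rewrite -{1}cats1 takel_cat; last exact: ltnW.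
by rewrite !onthE map_rcons nth_rcons size_map il.
Qed.

(** Induction on the number of rounds still to be played: the encoder of the next round sums to
    one. *)
Lemma sum_transcript_prob xs (pre : list 'I_K) : (size pre <= q)%nat ->
  \big[Rplus/0]_(fs : q.-tuple 'I_K | take (size pre) fs == pre) transcript_prob xs fs =
  prefix_prob xs pre.
Proof.
move: {2}(q - size pre)%nat (erefl (q - size pre)%nat) => d; elim: d pre => [|d IH] pre dE spq.
  have sq : size pre = q by lia.
  pose fs0 : q.-tuple 'I_K := tcast sq (in_tuple pre).
  have fs0E : tval fs0 = pre by rewrite val_tcast.
  rewrite (big_pred1 fs0) => [|fs]; last first.
    by rewrite take_oversize ?size_tuple ?sq //= -val_eqE /= fs0E.
  rewrite /transcript_prob /prefix_prob; apply: eq_big => [i|i _]; first by rewrite sq ltn_ord.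
  have [f0] : exists f : 'I_K, true by exists (tnth fs0 i).
  rewrite onthE (tnth_nth f0) fs0E (nth_map f0) // sq; exact: ltn_ord.
have lq : (size pre < q)%nat by lia.
pose l := Ordinal lq.
rewrite (partition_big (fun fs : q.-tuple 'I_K => tnth fs l) predT) //=.
transitivity (\rsum_f prefix_prob xs (rcons pre f)).
  apply: eq_bigr => f _; rewrite -IH ?size_rcons //; last by lia.
  apply: eq_bigl => fs; rewrite (tnth_nth f) (take_nth f) ?size_tuple //.
  by rewrite eqseq_rcons.
rewrite (eq_bigr (fun f => prefix_prob xs pre * enc c l xs pre f)); last first.
  by move=> f _; rewrite (@prefix_prob_rcons xs pre f l).
by rewrite -big_distrr /= enc_sum1 Rmult_1_r.
Qed.

Lemma joint_marginal xs : src_pmf p xs = \big[Rplus/0]_(w : Omega Y Z n q K | w.1 == xs) joint_pmf p c w.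
Proof.
have -> : \big[Rplus/0]_(w : Omega Y Z n q K | w.1 == xs) joint_pmf p c w =
    \big[Rplus/0]_(x | x == xs) \big[Rplus/0]_(fs : q.-tuple 'I_K) (src_pmf p x * transcript_prob x fs).
  rewrite (pair_big (fun x => x == xs) predT) /=.
  by apply: eq_big => [w|w _]; rewrite ?andbT // joint_pmfE.
rewrite big_pred1_eq -big_distrr /=.
have := @sum_transcript_prob xs [::] (leq0n _).
rewrite [prefix_prob _ _]big1 // => E; rewrite -[LHS]Rmult_1_r -E.
by congr (_ * _); apply: eq_bigl => fs; rewrite take0.
Qed.

Lemma joint_pmf_ge0 w : 0 <= joint_pmf p c w.
Proof.
rewrite joint_pmfE; apply: Rmult_le_pos; first by case: (src_pmf_pmf hp n) => h _; apply: h.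
by apply: rprod_ge0.
Qed.

Lemma joint_pmf_pmf : is_pmf (joint_pmf p c).
Proof.
split=> [w|]; first exact: joint_pmf_ge0.
rewrite sumRE (partition_big (fun w : Omega Y Z n q K => w.1) predT) //=.
rewrite -(pmf_sum1 (src_pmf_pmf hp n)); apply: eq_bigr => xs _.
by rewrite joint_marginal.
Qed.

Lemma prob_eq_prefix (V : eqType) (X : src Y Z n -> V) (l : nat) (w : Omega Y Z n q K) :
  (l <= q)%nat ->
  prob_eq (joint_pmf p c) (fun w => (X w.1, take l w.2)) (X w.1, take l w.2) =
  \big[Rplus/0]_(xs | X xs == X w.1) (src_pmf p xs * prefix_prob xs (take l w.2)).
Proof.
move=> lq; rewrite prob_eqE.
have sl : size (take l w.2) = l by rewrite size_take size_tuple; case: ltngtP lq.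
transitivity (\big[Rplus/0]_(xs | X xs == X w.1)
  \big[Rplus/0]_(fs : q.-tuple 'I_K | take l fs == take l w.2)
     (src_pmf p xs * transcript_prob xs fs)).
  rewrite (pair_big (fun xs => X xs == X w.1) (fun fs : q.-tuple 'I_K => take l fs == take l w.2)) /=.
  by apply: eq_big => w' *; rewrite ?xpair_eqE // joint_pmfE.
apply: eq_bigr => xs _; rewrite -big_distrr /=; congr (_ * _).
by rewrite -sum_transcript_prob sl.
Qed.

(** The conditional entropy of the message of round [l] given the whole source and the earlier
    messages. *)
Definition round_cost (l : 'I_q) : R :=
  - \rsum_w joint_pmf p c w * log2 (enc c l w.1 (take l w.2) (tnth w.2 l)).

(* The increment does not depend on [X]; hence the cancellations in the
   conditional mutual information of the two sides of a cut. *)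
Lemma entropy_round (V : eqType) (X : src Y Z n -> V) (l : 'I_q) :
  (forall xs xs', X xs = X xs' -> transmitter_agree l xs xs') ->
  entropy (joint_pmf p c) (fun w => (X w.1, take l.+1 w.2)) =
  entropy (joint_pmf p c) (fun w => (X w.1, take l w.2)) + round_cost l.
Proof.
move=> XT; rewrite !entropyE /round_cost -Ropp_plus_distr -big_split /=; congr (- _).
apply: eq_bigr => w _; rewrite -Rmult_plus_distr_l.
(* [X] determines what the sender sees, so the encoder is constant on the fibre of [X] and factors
   out of the sum. *)
have E : prob_eq (joint_pmf p c) (fun w => (X w.1, take l.+1 w.2)) (X w.1, take l.+1 w.2) =
    prob_eq (joint_pmf p c) (fun w => (X w.1, take l w.2)) (X w.1, take l w.2)
    * enc c l w.1 (take l w.2) (tnth w.2 l).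
  rewrite !prob_eq_prefix //; last exact: ltnW.
  rewrite big_distrl /=; apply: eq_bigr => xs /eqP Xxs.
  rewrite (take_nth (tnth w.2 l)) ?size_tuple // -tnth_nth.
  have sl : size (take l w.2) = l by rewrite size_take size_tuple ltn_ord.
  rewrite (@prefix_prob_rcons xs _ _ l) // Rmult_assoc; congr (_ * (_ * _)).
  by case: hc => _ [_ [h _]]; apply: h; apply: XT.
have [w0|<-] := joint_pmf_ge0 w; last by rewrite !Rmult_0_l.
congr (_ * _); rewrite E.
have pw : 0 < prob_eq (joint_pmf p c) (fun w => (X w.1, take l.+1 w.2)) (X w.1, take l.+1 w.2).
  exact: Rlt_le_trans w0 (prob_eq_ge joint_pmf_pmf (fun w => (X w.1, take l.+1 w.2)) w).
have pw' : 0 < prob_eq (joint_pmf p c) (fun w => (X w.1, take l w.2)) (X w.1, take l w.2).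
  exact: Rlt_le_trans w0 (prob_eq_ge joint_pmf_pmf (fun w => (X w.1, take l w.2)) w).
rewrite log2M //; move: pw; rewrite E.
by case: (enc_ge0 l w.1 (take l w.2) (tnth w.2 l)) => // <-; lra.
Qed.

Lemma joint_src_entropy (V : eqType) (X : src Y Z n -> V) :
  entropy (joint_pmf p c) (fun w => X w.1) = entropy (@src_pmf M Y Z p n) X.
Proof. exact: (push_entropy joint_marginal). Qed.

End Protocol.

(** * Converse *)

Section Masks.
Variable M : nat.

Definition msub (m1 m2 : mask M) : Prop :=
  forall k, ((m1 k).1 -> (m2 k).1) /\ ((m1 k).2 -> (m2 k).2).

Definition munion (m1 m2 : mask M) : mask M :=
  fun k => ((m1 k).1 || (m2 k).1, (m1 k).2 || (m2 k).2).

(** Mask form of [transmitter_agree]. Relays are numbered from 1 in the round robin and from 0 in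
    ['I_M], hence [t.-1]. *)
Definition sender_mask (l : nat) : mask M := fun k =>
  let t := (l.+1 %% M.+2)%nat in
  if t == 0%nat then (~~ k.2, false)
  else if t == M.+1 then (k.2, false) else (false, nat_of_ord k.1 == t.-1).

Variables (Y Z : 'I_M -> bool -> finType) (n : nat).

Lemma obs_msub m1 m2 (xs xs' : src Y Z n) :
  msub m1 m2 -> obs m2 xs = obs m2 xs' -> obs m1 xs = obs m1 xs'.
Proof.
move=> sub /obs_eq E; apply/obs_eq => j k; have [E1 E2] := E j k.
have [s1 s2] := sub k; split; [by move/s1|by move/s2].
Qed.

Lemma obs_munion m1 m2 (xs xs' : src Y Z n) :
  (obs (munion m1 m2) xs == obs (munion m1 m2) xs') =
  (obs m1 xs == obs m1 xs') && (obs m2 xs == obs m2 xs').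
Proof.
apply/eqP/andP => [E|[/eqP/obs_eq E1 /eqP/obs_eq E2]].
  by split; apply/eqP; apply: obs_msub E => k /=; split=> ->; rewrite ?orbT.
apply/obs_eq => j k; have [e1 e2] := E1 j k; have [e3 e4] := E2 j k.
by rewrite /=; split=> /orP[]; auto.
Qed.

Lemma sender_maskP l (xs xs' : src Y Z n) :
  obs (sender_mask l) xs = obs (sender_mask l) xs' -> transmitter_agree l xs xs'.
Proof.
move=> /obs_eq; rewrite /transmitter_agree /sender_mask /=.
case: eqP => _ /=; first by move=> E j i; have [e _] := E j (i, false); exact: e.
case: eqP => _ /=; first by move=> E j i; have [e _] := E j (i, true); exact: e.
by move=> E i il j a; have [_ e] := E j (i, a); apply: e; rewrite /= il.
Qed.

End Masks.

Section Converse.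
Variables (M : nat) (Y Z : 'I_M -> bool -> finType).
Variable p : forall i a, (Y i a * Z i a)%type -> R.
Hypothesis hp : forall i a, is_pmf (@p i a).
Variables (m0 : 'I_M) (side : 'I_M -> bool).

(* The relays other than [m0] are split between Alice ([side]) and Bob. *)
Definition alice_mask : mask M := fun k => (k.2, (k.1 != m0) && side k.1).
Definition bob_mask : mask M := fun k => (~~ k.2, (k.1 != m0) && ~~ side k.1).
Definition relay_mask (m : 'I_M) : mask M := fun k => (false, k.1 == m).

Local Notation mU := alice_mask.
Local Notation mV := bob_mask.
Local Notation mW := (relay_mask m0).
Local Notation mUW := (munion mU mW).
Local Notation mVW := (munion mV mW).
Local Notation mUVW := (munion mU (munion mV mW)).

(** Relays are assigned whole, with the relay ends of both their links, so no transmitter straddles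
    the cut. *)
Lemma sender_mask_sub l : msub (sender_mask l) mU \/ msub (sender_mask l) mV \/ msub (sender_mask l) mW.
Proof.
rewrite /sender_mask; set t := (l.+1 %% M.+2)%nat.
have tM : (t < M.+2)%nat by rewrite ltn_pmod.
case: eqP => t0; first by right; left=> k.
case: eqP => tM1; first by left=> k.
have tM2 : (t.-1 < M)%nat by lia.
pose i := Ordinal tM2.
have kE (k : 'I_M * bool) : (nat_of_ord k.1 == t.-1) -> k.1 = i by move=> /eqP e; apply: val_inj.
have [im|im] := eqVneq i m0.
  by right; right=> k /=; split=> // /kE ->; rewrite im.
case si: (side i); [left|right; left] => k /=; split=> // /kE ->; by rewrite im si.
Qed.

Section Code.
Variables (n q K Ka : nat) (c : code Y Z n q K Ka).
Hypothesis hc : valid_code c.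

Let P := joint_pmf p c.
Let Ppmf : is_pmf P := joint_pmf_pmf hp hc.
Let H (m : mask M) (l : nat) :=
  entropy P (fun w : Omega Y Z n q K => (obs m w.1, take l w.2)).

(* I(U; V | W, F^l) for the two sides U, V of the cut and the wiretapped relay W. *)
Let cmi l := H mUW l + H mVW l - H mUVW l - H mW l.

Let H_round m (l : 'I_q) : msub (sender_mask l) m -> H m l.+1 = H m l + round_cost p c l.
Proof.
move=> sub; apply: (entropy_round hp hc (X := obs m)) => xs xs' E.
by apply: sender_maskP; apply: obs_msub E.
Qed.

Let take_eqE (l : 'I_q) (fs fs' : q.-tuple 'I_K) :
  (take l.+1 fs == take l.+1 fs') = (tnth fs l == tnth fs' l) && (take l fs == take l fs').
Proof.
rewrite (take_nth (tnth fs l)) ?size_tuple // [take l.+1 fs'](take_nth (tnth fs l)) ?size_tuple //.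
by rewrite eqseq_rcons -!tnth_nth andbC.
Qed.

(** The conditional entropy of the next message given the past and [m2] cannot grow when [m1] is
    revealed as well. *)
Let H_submod m1 m2 (l : 'I_q) :
  H (munion m1 m2) l.+1 + H m2 l <= H (munion m1 m2) l + H m2 l.+1.
Proof.
have := @entropy_submod _ P Ppmf _ _ _ (fun w => obs m1 w.1) (fun w => tnth w.2 l)
  (fun w => (obs m2 w.1, take l w.2)).
rewrite -/(H m2 l).
rewrite (@entropy_ker _ P _ _ _ (fun w => (obs (munion m1 m2) w.1, take l.+1 w.2))); last first.
  by move=> w w'; rewrite !xpair_eqE obs_munion take_eqE; do !case: (_ == _).
rewrite (@entropy_ker _ P _ _ (fun w => (obs m1 w.1, _)) (fun w => (obs (munion m1 m2) w.1, take l w.2))); last first.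
  by move=> w w'; rewrite !xpair_eqE obs_munion andbA.
rewrite (@entropy_ker _ P _ _ (fun w => (tnth w.2 l, _)) (fun w => (obs m2 w.1, take l.+1 w.2))) //.
by move=> w w'; rewrite !xpair_eqE take_eqE; do !case: (_ == _).
Qed.

(** If the sender is on side U, the two terms containing U grow by the same [round_cost] and cancel;
    what is left is the entropy of the message given V, W minus its entropy given W. Side V is
    symmetric. If [m0] sends, all four terms grow equally. *)
Let cmi_round (l : 'I_q) : cmi l.+1 <= cmi l.
Proof.
have subU m : msub (sender_mask l) m -> forall m', msub (sender_mask l) (munion m m').
  by move=> s m' k; have [s1 s2] := s k; split=> [/s1|/s2] /= ->.
have subUr m : msub (sender_mask l) m -> forall m', msub (sender_mask l) (munion m' m).
  by move=> s m' k; have [s1 s2] := s k; split=> [/s1|/s2] /= ->; rewrite orbT.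
rewrite /cmi; case: (sender_mask_sub l) => [s|[s|s]].
- rewrite (@H_round mUW) ?(@H_round mUVW); auto.
  by have := H_submod mV mW l; lra.
- rewrite (@H_round mVW) ?(@H_round mUVW); auto.
  by have := H_submod mU mW l; lra.
- rewrite (@H_round mUW) ?(@H_round mVW) ?(@H_round mUVW) ?(@H_round mW); auto.
  lra.
Qed.

Let cmi_q : cmi q <= cmi 0.
Proof.
suff: forall l, (l <= q)%nat -> cmi l <= cmi 0 by apply.
elim=> [|l IH] lq; first lra.
have := cmi_round (Ordinal lq); have := IH (ltnW lq); rewrite /=; lra.
Qed.

Let H0 m : H m 0 = INR n * \rsum_k entropy (@pair_pmf M Y Z p k) (@view M Y Z (m k) k).
Proof.
rewrite -obs_entropy // -(joint_src_entropy p hc).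
by apply: entropy_ker => w w'; rewrite xpair_eqE !take0 eqxx andbT.
Qed.

(** The pairs contribute separately. Those of [m0] have their relay end in the conditioning, and a
    link to the terminal on the relay's own side lies within one block. Only the other link, of
    index [~~ side i], crosses the cut. *)
Let cmi_0 : cmi 0 = INR n * \rsum_i (if i == m0 then 0 else pair_mi p i (~~ side i)).
Proof.
have -> : cmi 0 = INR n * \rsum_k
   (entropy (@pair_pmf M Y Z p k) (@view M Y Z (mUW k) k)
    + entropy (@pair_pmf M Y Z p k) (@view M Y Z (mVW k) k)
    - entropy (@pair_pmf M Y Z p k) (@view M Y Z (mUVW k) k)
    - entropy (@pair_pmf M Y Z p k) (@view M Y Z (mW k) k)).
  by rewrite /cmi !H0 /Rminus !big_split /= !rsumN; ring.
congr (_ * _).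
transitivity (\rsum_i \rsum_(a : bool)
   (if i == m0 then 0 else if a == ~~ side i then pair_mi p i a else 0)).
  rewrite pair_bigA /=; apply: eq_bigr => -[i a] _ /=.
  rewrite !entropy_view // /munion /= /pair_mi /mutinfo.
  by case: (i == m0); case: (side i); case: a => /=; ring.
apply: eq_bigr => i _; rewrite big_bool /=.
by case: (i == m0); case: (side i) => /=; lra.
Qed.

Let KA (w : Omega Y Z n q K) := keyA c w.1 w.2.
Let KB (w : Omega Y Z n q K) := keyB c w.1 w.2.

Let KA_eq w w' : obs mU w.1 = obs mU w'.1 -> w.2 = w'.2 -> KA w = KA w'.
Proof.
move=> /obs_eq E EF; rewrite /KA EF; case: hc => _ [_ [_ [h _]]]; apply: h => j i.
by have [e _] := E j (i, true); apply: e.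
Qed.

Let KB_eq w w' : obs mV w.1 = obs mV w'.1 -> w.2 = w'.2 -> KB w = KB w'.
Proof.
move=> /obs_eq E EF; rewrite /KB EF; case: hc => _ [_ [_ [_ h]]]; apply: h => j i.
by have [e _] := E j (i, false); apply: e.
Qed.

Let take_q (fs fs' : q.-tuple 'I_K) : (take q fs == take q fs') = (fs == fs').
Proof. by rewrite !take_oversize ?size_tuple. Qed.

Lemma relay_obsE m (xs xs' : src Y Z n) :
  (relay_obs m xs == relay_obs m xs') = (obs (relay_mask m) xs == obs (relay_mask m) xs').
Proof.
apply/eqP/eqP => [/ffunP E|/obs_eq E].
  apply/obs_eq => j [i a] /=; split=> // /eqP im.
  have := E j; rewrite !ffunE /= => -[]; rewrite im.
  by case: a.
apply/ffunP => j; rewrite !ffunE.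
have [_ /= e1] := E j (m, true); have [_ /= e2] := E j (m, false).
by rewrite e1 // e2.
Qed.

(** Write F for the transcript. As [KA] is a function of (U, F), data processing gives H(KA | W, F)
    - H(KA | V, W, F) <= I(U; V | W, F) ([h2]). As [KB] is a function of (V, F), H(KA | V, W, F) <=
    H(KA | KB) ([h1]), which Fano bounds. The rest of the entropy of [KA] is the leakage to [m0]. *)
Lemma key_entropy_bound eta : 0 < eta < 1 ->
  \rsum_(w | KA w != KB w) P w <= eta ->
  entropy P KA <= mutinfo P KA (fun w => (relay_obs m0 w.1, w.2))
    + INR n * (\rsum_i (if i == m0 then 0 else pair_mi p i (~~ side i)))
    + fano_bound eta + eta * log2 (INR Ka).
Proof.
move=> eta01 err; rewrite -cmi_0; have := cmi_q.
have := @fano _ P Ppmf _ _ KA KB (fun w => KA w == KB w) eta eta01 err.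
rewrite card_ord => fanoK.
have {}fanoK := fanoK (fun w w' (a : KA w == KB w) (b : KA w' == KB w') e =>
  etrans (eqP a) (etrans e (esym (eqP b)))).
pose C w := (KA w, (obs mW w.1, w.2)).
have -> : mutinfo P KA (fun w => (relay_obs m0 w.1, w.2)) =
    entropy P KA + H mW q - entropy P C.
  rewrite /mutinfo; congr (_ + _ - _); apply: entropy_ker => w w'.
    by rewrite !xpair_eqE relay_obsE take_q.
  by rewrite !xpair_eqE relay_obsE.
have := @entropy_submod _ P Ppmf _ _ _ (fun w => obs mU w.1) (fun w => obs mV w.1) C.
rewrite (@entropy_ker _ P _ _ (fun w => (obs mU w.1, (obs mV w.1, C w)))
  (fun w => (obs mUVW w.1, take q w.2))); last first.
  move=> w w'; rewrite !xpair_eqE take_q !obs_munion.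
  case: (obs mU _ =P _) => [EU|_] //; case: (w.2 =P _) => [EF|_]; last by rewrite !andbF.
  by rewrite (KA_eq EU EF) eqxx /= !andbT.
rewrite (@entropy_ker _ P _ _ (fun w => (obs mU w.1, C w))
  (fun w => (obs mUW w.1, take q w.2))); last first.
  move=> w w'; rewrite !xpair_eqE take_q !obs_munion.
  case: (obs mU _ =P _) => [EU|_] //; case: (w.2 =P _) => [EF|_]; last by rewrite !andbF.
  by rewrite (KA_eq EU EF) eqxx /= !andbT.
have := @entropy_submod _ P Ppmf _ _ _ KA (fun w => (obs mV w.1, (obs mW w.1, w.2))) KB.
rewrite (@entropy_ker _ P _ _ (fun w => (KA w, ((obs mV w.1, (obs mW w.1, w.2)), KB w)))
  (fun w => (obs mV w.1, C w))); last first.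
  move=> w w'; rewrite !xpair_eqE.
  case: (obs mV _ =P _) => [EV|_]; last by rewrite !andbF.
  case: (w.2 =P _) => [EF|_]; last by rewrite !andbF.
  by rewrite (KB_eq EV EF) eqxx /= !andbT.
rewrite (@entropy_ker _ P _ _ (fun w => ((obs mV w.1, (obs mW w.1, w.2)), KB w))
  (fun w => (obs mVW w.1, take q w.2))); last first.
  move=> w w'; rewrite !xpair_eqE take_q !obs_munion.
  case: (obs mV _ =P _) => [EV|_] //; case: (w.2 =P _) => [EF|_]; last by rewrite !andbF.
  by rewrite (KB_eq EV EF) eqxx /= !andbT.
set eVC := entropy P (fun w => (obs mV w.1, C w)) => h1 h2.
pose eAB := entropy P (fun w => (KA w, KB w)); pose eB := entropy P KB; pose eC := entropy P C.
pose eA := entropy P KA.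
have {}fanoK : eAB <= eB + fano_bound eta + eta * log2 (INR Ka) := fanoK.
have {}h1 : eVC + eB <= eAB + H mVW q := h1.
have {}h2 : H mUVW q + eC <= H mUW q + eVC := h2.
rewrite /cmi => h3.
change (eA <= eA + H mW q - eC + (H mUW 0%nat + H mVW 0%nat - H mUVW 0%nat - H mW 0%nat)
  + fano_bound eta + eta * log2 (INR Ka)).
clearbody eVC eAB eA eB eC H; lra.
Qed.

End Code.
End Converse.

(** * The bound on the rate as the error vanishes *)

Lemma fano_bound_ge0 eta : 0 < eta < 1 -> 0 <= fano_bound eta.
Proof.
move=> h; have le0 x : 0 < x <= 1 -> log2 x <= 0 by move=> ?; rewrite -log2_1; apply: log2_le; lra.
have h1 : log2 (1 - eta) <= 0 by apply: le0; lra.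
have h2 : log2 eta <= 0 by apply: le0; lra.
by rewrite /fano_bound; nra.
Qed.

(** At a square the term [eta * log2 eta] is bounded linearly in [t], from [- ln t <= / t - 1]; in
    the converse every error term thereby becomes linear in [t]. *)
Lemma fano_bound_sqr t : 0 < t <= 1 / 2 -> fano_bound (t * t) <= 4 * t / ln 2.
Proof.
move=> t12; have tt : 0 < t * t <= t / 2 by nra.
have l2 := ln2_gt0.
have h1 : - ln (1 - t * t) <= 2 * (t * t).
  rewrite -ln_Rinv; last lra.
  have i0 : 0 < / (1 - t * t) by apply: Rinv_0_lt_compat; lra.
  apply: Rle_trans (ln_le_sub1 i0) _.
  apply: (Rmult_le_reg_r (1 - t * t)); first lra.
  by rewrite Rmult_minus_distr_r Rinv_l; nra.
have h2 : - ln t <= / t - 1.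
  by rewrite -ln_Rinv; [apply: ln_le_sub1; apply: Rinv_0_lt_compat|]; lra.
have h3 : - (t * t * ln (t * t)) <= 2 * t.
  rewrite ln_mult; try lra.
  have -> : - (t * t * (ln t + ln t)) = 2 * (t * t) * (- ln t) by ring.
  apply: (@Rle_trans _ (2 * (t * t) * (/ t - 1))); first by apply: Rmult_le_compat_l; lra.
  have -> : 2 * (t * t) * (/ t - 1) = 2 * t - 2 * (t * t) by field; lra.
  by nra.
have -> : fano_bound (t * t) = (- ln (1 - t * t) - t * t * ln (t * t)) / ln 2.
  by rewrite /fano_bound /log2; field; lra.
apply: Rmult_le_compat_r; first by left; apply: Rinv_0_lt_compat.
by nra.
Qed.

Lemma div_le_of (x y n : R) : 0 < n -> x <= n * y -> x / n <= y.
Proof.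
move=> n0 h; apply: (Rmult_le_reg_r n) => //.
by rewrite /Rdiv Rmult_assoc Rinv_l; lra.
Qed.

Lemma le_of_div (x y n : R) : 0 < n -> x / n <= y -> x <= n * y.
Proof.
move=> n0 h; have -> : x = n * (x / n) by field; lra.
by apply: Rmult_le_compat_l; lra.
Qed.

Lemma sum_except (M : nat) (m0 : 'I_M) (F : 'I_M -> R) :
  \rsum_i (if i == m0 then 0 else F i) = sumR F - F m0.
Proof.
rewrite sumRE (bigD1 m0) //= [in RHS](bigD1 m0) //= eqxx.
rewrite (eq_bigr F); first by lra.
by move=> i /negbTE ->.
Qed.

(** One bound for each choice of wiretapped relay; the relay of largest [Imin] gives the
    tightest. *)
Lemma converse (M : nat) (Y Z : 'I_M -> bool -> finType)
    (p : forall i a, (Y i a * Z i a)%type -> R) (hp : forall i a, is_pmf (@p i a))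
    (m0 : 'I_M) (Rate : R) :
  achievable p Rate -> Rate <= sumR (Imin p) - Imin p m0.
Proof.
move=> ach; set sigma := _ - _.
pose side i : bool := Rle_dec (pair_mi p i false) (pair_mi p i true).
have sideE : \rsum_i (if i == m0 then 0 else pair_mi p i (~~ side i)) = sigma.
  rewrite /sigma -sum_except; apply: eq_bigr => i _; case: ifP => // _.
  rewrite /side /Imin; case: Rle_dec => h /=.
    by rewrite Rmin_right.
  by rewrite Rmin_left //; lra.
apply: le_epsilon => d d0; have l2 := ln2_gt0.
(* Collects the coefficients of [t] in the final estimate: [2 * eps], the product [eps * Rate] of a
   rate of unknown sign, and the Fano term. *)
pose B := 2 + Rabs Rate + 4 / ln 2.
have B0 : 0 < B.
  have := Rabs_pos Rate; have : 0 < 4 / ln 2 by apply: Rdiv_lt_0_compat; lra.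
  by rewrite /B; lra.
pose t := Rmin (1 / 2) (d / B).
have t0 : 0 < t by apply: Rmin_glb_lt; [lra|exact: Rdiv_lt_0_compat].
have t2 : t <= 1 / 2 by exact: Rmin_l.
have tB : t * B <= d.
  apply: (@Rle_trans _ (d / B * B)); first by apply: Rmult_le_compat_r; [lra|exact: Rmin_r].
  by right; field; lra.
pose eps := t * t.
have eps0 : 0 < eps <= t by rewrite /eps; nra.
have [n [q [K [Ka [c [n0 [hc [err [rate [unif sec]]]]]]]]]] := ach eps (proj1 eps0).
have eps1 : 0 < eps < 1 by lra.
have n1 : 1 <= INR n by rewrite -[1]/(INR 1); apply: le_INR; apply/leP.
have err' : \rsum_(w | keyA c w.1 w.2 != keyB c w.1 w.2) joint_pmf p c w <= eps.
  by move: err; rewrite sumRE -big_mkcond.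
have := @key_entropy_bound M Y Z p hp m0 side n q K Ka c hc eps eps1 err'.
have f1 := @fano_bound_ge0 eps eps1; have f2 : fano_bound eps <= 4 * t / ln 2 by exact: fano_bound_sqr.
have := sec m0; move: rate unif; rewrite sideE /=.
set h := entropy _ _; set I := mutinfo _ _ _; set F := fano_bound eps in f1 f2 *.
set L := log2 (INR Ka) => rate unif Im hb.
have Im' : I <= INR n * eps by apply: le_of_div => //; lra.
(* Near uniformity bounds the key alphabet by the key entropy itself; otherwise the Fano term
   [eps * L] would be out of control. *)
have L' : L <= INR n * (h / INR n + eps) by apply: le_of_div; lra.
have hE : INR n * (h / INR n) = h by field; lra.
have F' : F <= INR n * F by nra.
have hb' : h / INR n <= eps + sigma + F + eps * (h / INR n + eps).
  apply: div_le_of; first lra.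
  by nra.
have Ra := Rle_abs Rate; have Ra0 := Rabs_pos Rate.
have h4 : 4 * t / ln 2 = t * (4 / ln 2) by field; lra.
have r1 : Rate * (1 - eps) <= sigma + 2 * eps + F.
  have : (Rate - eps) * (1 - eps) <= h / INR n * (1 - eps) by apply: Rmult_le_compat_r; lra.
  by nra.
have r2 : Rate <= sigma + 2 * t + F + t * Rabs Rate.
  have : eps * Rate <= t * Rabs Rate by apply: (@Rle_trans _ (eps * Rabs Rate)); nra.
  by lra.
by move: tB; rewrite /B; lra.
Qed.

(** * Sums of order statistics *)

Lemma sum_perm (s t : list R) : Permutation s t ->
  fold_right Rplus 0 s = fold_right Rplus 0 t.
Proof. by induction 1; rewrite /= ?IHPermutation //; lra. Qed.

Lemma sorted_rcons_max (l : list R) (x y : R) :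
  StronglySorted Rle (List.app l (x :: nil)) -> In y l -> y <= x.
Proof.
elim: l => //= a l IH sal; have [ss /Forall_forall al] := StronglySorted_inv sal.
case=> [<-|yl]; last exact: IH.
by apply: al; apply/in_or_app; right; left.
Qed.

Lemma sum_sorted_butlast (s : list R) (mx : R) :
  Sorted Rle s -> In mx s -> (forall y, In y s -> y <= mx) ->
  fold_right Rplus 0 s - mx = fold_right Rplus 0 (firstn (Nat.pred (length s)) s).
Proof.
move=> ss mxs mxP; have sn : s <> nil by move=> s0; move: mxs; rewrite s0.
rewrite -removelast_firstn_len.
have E := app_removelast_last 0 sn; set l := removelast s in E *; set x := List.last s 0 in E.
have Es : fold_right Rplus 0 s = fold_right Rplus 0 l + x.
  rewrite E fold_right_app /= Rplus_0_r; elim: (l) => [|a r IH] /=; first lra.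
  by rewrite IH; lra.
suff -> : mx = x by rewrite Es; lra.
apply: Rle_antisym; last first.
  by apply: mxP; rewrite E; apply/in_or_app; right; left.
move: mxs; rewrite E => /in_app_iff [mxl|[->|//]]; last exact: Rle_refl.
apply: sorted_rcons_max mxl; rewrite -E.
by apply: Sorted_StronglySorted => // a b c; exact: Rle_trans.
Qed.

Lemma sum_sorted_except_max (M : nat) (F : 'I_M -> R) (m0 : 'I_M) (hm0 : forall m, F m <= F m0)
    (s : list R) :
  Permutation s (map F (enum 'I_M)) -> Sorted Rle s ->
  sumR F - F m0 = fold_right Rplus 0 (firstn (M - 1)%nat s).
Proof.
move=> perm ss.
have memE y : In y (map F (enum 'I_M)) -> exists i, y = F i.
  by rewrite in_map_iff => -[i [<- _]]; exists i.
have len : length s = M.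
  by rewrite (Permutation_length perm) length_map -[length _]/(size _) -cardE card_ord.
have -> : sumR F = fold_right Rplus 0 s by rewrite (sum_perm perm).
rewrite (@sum_sorted_butlast s (F m0)) //.
- by rewrite len subn1.
- apply: Permutation_in (Permutation_sym perm) _; apply: in_map.
  have : m0 \in enum 'I_M by rewrite mem_enum.
  elim: (enum 'I_M) => //= a l IH; rewrite inE => /orP[/eqP ->|/IH]; first by left.
  by right.
- by move=> y /(Permutation_in _ perm) /memE [i ->].
Qed.

(** * Random binning *)

Lemma exists_le_avg (C : finType) (c0 : C) (F : C -> R) (a : R) :
  \rsum_c F c <= INR #|C| * a -> exists c, F c <= a.
Proof.
move=> Fa; case: (boolP [exists c, Rle_dec (F c) a : bool]) => [/existsP[c]|/existsPn none].
  by case: Rle_dec => // h _; exists c.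
have lt c : a < F c by have := none c; case: Rle_dec => //= h _; exact: Rnot_le_lt.
have : \rsum_(c : C) a < \rsum_c F c.
  rewrite (bigD1 c0) //= [X in _ < X](bigD1 c0) //=.
  by apply: Rplus_lt_le_compat; [exact: lt|apply: rsum_le => c _; left; exact: lt].
by rewrite rsum_const; lra.
Qed.

Lemma rsum_indicator (T : finType) (b : pred T) :
  \rsum_t (if b t then 1 else 0) = INR #|[pred t | b t]|.
Proof.
by rewrite -sum1_card (big_morph INR plus_INR (erefl (INR 0))) -big_mkcond.
Qed.

(* Derandomized random coloring: colors are chosen greedily. *)
Lemma greedy_coloring (V : eqType) (C : finType) (c0 : C)
    (cost : V -> V -> C -> C -> R) (avg : V -> V -> R) (s : list V) :
  (forall v v' d, \rsum_c cost v v' c d <= INR #|C| * avg v v') ->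
  (forall v v' d, \rsum_c cost v v' d c <= INR #|C| * avg v v') ->
  uniq s ->
  exists h : V -> C,
    \rsum_(v <- s) \rsum_(v' <- s | v' != v) cost v v' (h v) (h v') <=
    \rsum_(v <- s) \rsum_(v' <- s | v' != v) avg v v'.
Proof.
move=> avgl avgr; elim: s => [|x s IH] /=.
  by move=> _; exists (fun=> c0); rewrite !big_nil; lra.
move=> /andP[xs us]; have [h hP] := IH us.
have split_cons (F : V -> V -> R) :
    \rsum_(v <- x :: s) \rsum_(v' <- x :: s | v' != v) F v v' =
    \rsum_(v <- s) (F x v + F v x) + \rsum_(v <- s) \rsum_(v' <- s | v' != v) F v v'.
  have ne v : v \in s -> v != x by apply: contraTneq => ->.
  rewrite big_cons big_cons eqxx /= big_split /= Rplus_assoc; congr (_ + _).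
    rewrite big_seq_cond [RHS]big_seq; apply: eq_bigl => v.
    by case: (boolP (v \in s)) => //= /ne ->.
  rewrite -big_split /= big_seq [RHS]big_seq; apply: eq_bigr => v vs.
  by rewrite big_cons eq_sym ne.
(* Method of conditional expectations: the colors on [s] are fixed, and some color for [x] does no
   worse than the average against them. *)
have [c cP] : exists c, \rsum_(v <- s) (cost x v c (h v) + cost v x (h v) c) <=
    \rsum_(v <- s) (avg x v + avg v x).
  apply: exists_le_avg => //; rewrite exchange_big big_distrr /=.
  apply: rsum_le => v _; rewrite big_split /= Rmult_plus_distr_l.
  exact: Rplus_le_compat.
exists (fun v => if v == x then c else h v); rewrite !split_cons.
apply: Rplus_le_compat.
  rewrite (eq_big_seq (fun v => cost x v c (h v) + cost v x (h v) c)) // => v vs.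
  by rewrite eqxx; case: eqP => // vx; move: xs; rewrite -vx vs.
rewrite (eq_big_seq (fun v => \rsum_(v' <- s | v' != v) cost v v' (h v) (h v'))) // => v vs.
rewrite big_seq_cond [RHS]big_seq_cond; apply: eq_bigr => v' /andP[v's _].
have -> : (v == x) = false by apply/negP => /eqP vx; move: xs; rewrite -vx vs.
by have -> : (v' == x) = false by apply/negP => /eqP vx; move: xs; rewrite -vx v's.
Qed.

Section Binning.
Variables (Om : finType) (P : Om -> R) (Ppmf : is_pmf P).
Variables (U V : finType) (X : Om -> U) (W : Om -> V).

Let P0 w : 0 <= P w. Proof. by case: Ppmf. Qed.

(** Probability that the source is [v] while the test [S] also accepts [v'], that is, of the event
    on which a shared bin may confuse the two. *)
Definition rivals (S : U -> V -> bool) (v v' : V) : R :=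
  \rsum_(w | W w == v) P w * (if S (X w) v' then 1 else 0).

Lemma rivals_ge0 S v v' : 0 <= rivals S v v'.
Proof.
by apply: rsum_ge0 => w _; apply: Rmult_le_pos; [exact: P0|case: ifP; lra].
Qed.

Lemma rivals_sum S N : (forall u, INR #|[pred v | S u v]| <= N) ->
  \rsum_v \rsum_(v' | v' != v) rivals S v v' <= N.
Proof.
move=> SN.
apply: (@Rle_trans _ (\rsum_v \rsum_v' rivals S v v')).
  by apply: rsum_le => v _; apply: rsum_pred_le => // v'; exact: rivals_ge0.
have -> : \rsum_v \rsum_v' rivals S v v' = \rsum_w P w * INR #|[pred v | S (X w) v]|.
  rewrite (partition_big W predT) //=; apply: eq_bigr => v _.
  rewrite exchange_big /=; apply: eq_bigr => w _; rewrite -big_distrr /=.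
  by congr (_ * _); exact: rsum_indicator.
have -> : N = \rsum_w P w * N by rewrite -big_distrl /= pmf_sum1 // Rmult_1_l.
by apply: rsum_le => w _; apply: Rmult_le_compat_l.
Qed.

Definition bin_decoder (D : eqType) (S : U -> V -> bool) (k : V -> D) (v0 : V) (u : U) (b : D) : V :=
  odflt v0 [pick v | S u v & k v == b].

(** An error means that the true value fails the test, or that an accepted rival shares its bin; the
    second event is bounded by summing over rivals. *)
Lemma bin_decoder_error (D : eqType) S (k : V -> D) v0 :
  \rsum_(w | bin_decoder S k v0 (X w) (k (W w)) != W w) P w <=
  \rsum_(w | ~~ S (X w) (W w)) P w +
  \rsum_v \rsum_(v' | v' != v) rivals S v v' * (if k v' == k v then 1 else 0).
Proof.
have -> : \rsum_v \rsum_(v' | v' != v) rivals S v v' * (if k v' == k v then 1 else 0) =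
    \rsum_w P w * (\rsum_(v' | v' != W w) (if S (X w) v' && (k v' == k (W w)) then 1 else 0)).
  rewrite [RHS](partition_big W predT) //=; apply: eq_bigr => v _.
  under [LHS]eq_bigr => v' _ do rewrite /rivals big_distrl /=.
  rewrite exchange_big /=; apply: eq_bigr => w /eqP ->; rewrite big_distrr /=.
  by apply: eq_bigr => v' _; rewrite Rmult_assoc; congr (_ * _); do 2!case: ifP => //=; lra.
rewrite big_mkcond [X in X + _]big_mkcond -big_split /=; apply: rsum_le => w _.
set T := bigop _ _ _.
have T0 : 0 <= T by apply: rsum_ge0 => v _; case: ifP; lra.
have Pw := P0 w; have PT := Rmult_le_pos _ _ Pw T0.
case: ifP => bad; last by case: ifP; lra.
case: (boolP (S (X w) (W w))) => /= SW; last lra.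
suff : 1 <= T by have := Rmult_le_compat_l _ 1 T Pw; lra.
move: bad; rewrite /bin_decoder; case: pickP => [v /andP[Sv kv]|/(_ (W w))]; last first.
  by rewrite SW eqxx.
rewrite /= => vW; rewrite /T.
have := @rsum_ge_term _ (fun v => v != W w)
  (fun v' => if S (X w) v' && (k v' == k (W w)) then 1 else 0) v.
by rewrite Sv kv /=; apply=> // v'; case: ifP; lra.
Qed.

(** One coloring by pairs must serve two decoders: the first reads only the first coordinate but has
    side information, the second reads the whole color without it. Their collision costs are added
    before derandomizing; collisions have averages [/ A] and [/ (A * B)]. *)
Lemma binning (S1 : U -> V -> bool) (S2 : V -> bool) (N1 N2 : R) (A B : nat) :
  (0 < A)%nat -> (0 < B)%nat ->
  (forall u, INR #|[pred v | S1 u v]| <= N1) -> INR #|[pred v | S2 v]| <= N2 ->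
  exists (f g : V -> nat) (dec1 : U -> nat -> V) (dec2 : nat -> nat -> V),
    [/\ (forall v, (f v < A)%nat), (forall v, (g v < B)%nat) &
      \rsum_(w | dec1 (X w) (f (W w)) != W w) P w +
      \rsum_(w | dec2 (f (W w)) (g (W w)) != W w) P w <=
      \rsum_(w | ~~ S1 (X w) (W w)) P w + \rsum_(w | ~~ S2 (W w)) P w
      + N1 / INR A + N2 / (INR A * INR B)].
Proof.
move=> A0 B0 S1N S2N.
have [w0 _] := pmf_inhabited Ppmf; pose v0 := W w0.
pose C : finType := ('I_A * 'I_B)%type.
pose S2' (u : U) := S2.
have rA : 0 < INR A by apply: lt_0_INR; apply/ltP.
have rB : 0 < INR B by apply: lt_0_INR; apply/ltP.
have cC : INR #|C| = INR A * INR B by rewrite card_prod !card_ord -mult_INR.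
pose one (b : bool) : R := if b then 1 else 0.
pose cost v v' (c d : C) := rivals S1 v v' * one (d.1 == c.1) + rivals S2' v v' * one (d == c).
pose avg v v' := rivals S1 v v' / INR A + rivals S2' v v' / (INR A * INR B).
have sum1 (d : C) : \rsum_(c : C) one (d.1 == c.1) = INR B.
  rewrite -(pair_bigA _ (fun a (b : 'I_B) => one (d.1 == a))) /=.
  transitivity (\rsum_(a : 'I_A) (if a == d.1 then INR B else 0)).
    apply: eq_bigr => a _; rewrite rsum_const card_ord eq_sym /one; case: ifP; lra.
  by rewrite rsum_pick.
have sum2 (d : C) : \rsum_(c : C) one (d == c) = 1.
  by rewrite -(rsum_pick d (fun=> 1)); apply: eq_bigr => c _; rewrite eq_sym.
have avgE v v' : INR #|C| * avg v v' = rivals S1 v v' * INR B + rivals S2' v v' * 1.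
  by rewrite cC /avg; field; lra.
have [] := @greedy_coloring V C (Ordinal A0, Ordinal B0) cost avg (index_enum V).
- move=> v v' d; rewrite avgE /cost big_split /= -!big_distrr /= sum1 sum2.
  exact: Rle_refl.
- move=> v v' d; rewrite avgE /cost big_split /= -!big_distrr /=.
  under eq_bigr => c _ do rewrite eq_sym.
  under [X in _ + _ * X]eq_bigr => c _ do rewrite eq_sym.
  by rewrite sum1 sum2; exact: Rle_refl.
- exact: index_enum_uniq.
move=> h hP.
pose f v := nat_of_ord (h v).1; pose g v := nat_of_ord (h v).2.
exists f, g, (bin_decoder S1 f v0),
  (* [X w0] is a dummy argument: [S2'] ignores the side information. *)
  (fun a b => bin_decoder S2' (fun v => (f v, g v)) v0 (X w0) (a, b)).
split=> [v|v|]; try exact: ltn_ord.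
have E1 := @bin_decoder_error _ S1 f v0.
have E2 := @bin_decoder_error _ S2' (fun v => (f v, g v)) v0.
have E2' : \rsum_(w | bin_decoder S2' (fun v => (f v, g v)) v0 (X w0) (f (W w), g (W w)) != W w) P w
  = \rsum_(w | bin_decoder S2' (fun v => (f v, g v)) v0 (X w) (f (W w), g (W w)) != W w) P w by [].
rewrite E2'.
suff : \rsum_v \rsum_(v' | v' != v) rivals S1 v v' * (if f v' == f v then 1 else 0) +
    \rsum_v \rsum_(v' | v' != v) rivals S2' v v' * (if (f v', g v') == (f v, g v) then 1 else 0)
    <= N1 / INR A + N2 / (INR A * INR B).
  by move: E1 E2; rewrite {2}/S2'; lra.
apply: (@Rle_trans _ (\rsum_v \rsum_(v' | v' != v) cost v v' (h v) (h v'))).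
  right; rewrite -big_split /=; apply: eq_bigr => v _.
  rewrite -big_split /=; apply: eq_bigr => v' _; rewrite /cost /one.
  by congr (_ + _ * _); rewrite !xpair_eqE -!val_eqE /=; case: (h v) (h v') => a b [a' b'].
apply: Rle_trans hP _.
have r1 := rivals_sum S1N; have r2 : \rsum_v \rsum_(v' | v' != v) rivals S2' v v' <= N2.
  by apply: rivals_sum => u.
have -> : \rsum_v \rsum_(v' | v' != v) avg v v' =
    (\rsum_v \rsum_(v' | v' != v) rivals S1 v v') / INR A +
    (\rsum_v \rsum_(v' | v' != v) rivals S2' v v') / (INR A * INR B).
  rewrite /Rdiv !big_distrl -big_split /=; apply: eq_bigr => v _.
  by rewrite !big_distrl -big_split /=.
apply: Rplus_le_compat; apply: Rmult_le_compat_r => //; left; apply: Rinv_0_lt_compat => //.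
exact: Rmult_lt_0_compat.
Qed.

End Binning.

(** * Typical sequences *)

(** From [1 - x <= exp (- x)] one gets [exp x <= / (1 - x)], and (1 - x)(1 + x + 2 x^2) = 1 + x^2 (1
    - 2 x) is at least 1 here. *)
Lemma exp_quadratic x : Rabs x <= 1 / 2 -> exp x <= 1 + x + 2 * (x * x).
Proof.
move=> ax; have hx : - (1 / 2) <= x <= 1 / 2.
  by have := Rle_abs x; have := Rle_abs (- x); rewrite Rabs_Ropp; lra.
have h : 1 - x <= exp (- x) by have := exp_ineq1_le (- x); lra.
have e0 := exp_pos x.
apply: (@Rle_trans _ (/ (1 - x))).
  rewrite -[exp x]Rinv_inv -exp_Ropp; apply: Rinv_le_contravar; lra.
apply: (Rmult_le_reg_r (1 - x)); first lra.
by rewrite Rinv_l; nra.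
Qed.

Section Tail.
Variables (T : finType) (p : T -> R) (p_pmf : is_pmf p).

Let p0 t : 0 <= p t. Proof. by case: p_pmf. Qed.

Definition iid (n : nat) (c : {ffun 'I_n -> T}) : R := prod_law (fun=> p) c.

Lemma iid_pmf n : is_pmf (@iid n).
Proof. exact: prod_law_pmf. Qed.

Lemma chernoff (phi : T -> R) (delta : R) : 0 < delta ->
  exists rho, 0 <= rho < 1 /\ forall n,
    \big[Rplus/0]_(c : {ffun 'I_n -> T} |
        Rlt_dec (INR n * (\rsum_t p t * phi t + delta)) (\rsum_j phi (c j))) iid c
    <= pow rho n.
Proof.
move=> d0; set mu := \rsum_t p t * phi t.
pose psi t := phi t - mu - delta.
pose B := 1 + \rsum_t Rabs (psi t).
have B1 : 1 <= B by have := @rsum_ge0 _ (index_enum T) xpredT (fun t => Rabs (psi t)) (fun t _ => Rabs_pos _); rewrite /B; lra.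
have psiB t : Rabs (psi t) <= B.
  have := @rsum_ge_term _ xpredT (fun t => Rabs (psi t)) t (fun t => Rabs_pos _) isT.
  by rewrite /B; lra.
(* The first bound brings [s * psi] into the range of [exp_quadratic]; the second makes the
   quadratic term at most half of the linear gain [s * delta], so that [rho < 1]. *)
pose s := Rmin (/ (2 * B)) (delta / (4 * (B * B))).
have s0 : 0 < s.
  apply: Rmin_glb_lt; first by apply: Rinv_0_lt_compat; lra.
  by apply: Rdiv_lt_0_compat; nra.
have sB : s * B <= 1 / 2.
  apply: (@Rle_trans _ (/ (2 * B) * B)); first by apply: Rmult_le_compat_r; [lra|exact: Rmin_l].
  by right; field; lra.
have sB2 : s * (B * B) <= delta / 4.
  apply: (@Rle_trans _ (delta / (4 * (B * B)) * (B * B))).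
    by apply: Rmult_le_compat_r; [nra|exact: Rmin_r].
  by right; field; lra.
pose rho := \rsum_t p t * exp (s * psi t).
have rho0 : 0 <= rho.
  by apply: rsum_ge0 => t _; apply: Rmult_le_pos => //; left; exact: exp_pos.
exists rho; split.
  split=> //.
  apply: (@Rle_lt_trans _ (\rsum_t p t * (1 + s * psi t + 2 * (s * s) * (B * B)))).
    apply: rsum_le => t _; apply: Rmult_le_compat_l => //.
    have pB := psiB t; have pa := Rabs_pos (psi t).
    apply: (@Rle_trans _ (1 + s * psi t + 2 * ((s * psi t) * (s * psi t)))).
      apply: exp_quadratic; rewrite Rabs_mult (Rabs_pos_eq s); last lra.
      by apply: Rle_trans sB; apply: Rmult_le_compat_l; lra.
    have psi2 : psi t * psi t <= B * B.
      by have := Rle_abs (psi t); have := Rle_abs (- psi t); rewrite Rabs_Ropp; nra.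
    have s2 : 0 <= s * s by nra.
    by have := Rmult_le_compat_l _ _ _ s2 psi2; lra.
  have -> : \rsum_t p t * (1 + s * psi t + 2 * (s * s) * (B * B)) =
      (1 - s * (mu + delta) + 2 * (s * s) * (B * B)) * (\rsum_t p t) + s * mu.
    rewrite /mu !big_distrr -big_split /=; apply: eq_bigr => t _.
    by rewrite /psi -/mu; ring.
  rewrite pmf_sum1 //; nra.
move=> n.
have -> : pow rho n = \rsum_(c : {ffun 'I_n -> T}) \rprod_j (p (c j) * exp (s * psi (c j))).
  rewrite (@dffun_distr 'I_n (fun=> T) (fun _ t => p t * exp (s * psi t))).
  by rewrite rprod_const card_ord.
rewrite big_mkcond /=; apply: rsum_le => c _.
have ic0 : 0 <= iid c by case: (iid_pmf n) => h _; apply: h.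
rewrite big_split /=.
have -> : \rprod_j exp (s * psi (c j)) = exp (s * \rsum_j psi (c j)).
  rewrite big_distrr /=; apply/esym; apply: (big_morph exp); [exact: exp_plus|exact: exp_0].
case: Rlt_dec => /= h; last by apply: Rmult_le_pos; [exact: ic0|left; exact: exp_pos].
rewrite -[iid c]Rmult_1_r; apply: Rmult_le_compat_l => //.
rewrite -exp_0; left; apply: exp_increasing; apply: Rmult_lt_0_compat => //.
rewrite /psi; have -> : \rsum_j (phi (c j) - mu - delta) = \rsum_j phi (c j) - INR n * (mu + delta).
  rewrite -[X in INR X](card_ord n) -rsum_const /Rminus -rsumN -big_split /=.
  by apply: eq_bigr => j _; ring.
by apply/Rlt_0_minus; exact: h.
Qed.

Lemma iid_tail (phi : T -> R) (delta d : R) : 0 < delta -> 0 < d ->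
  exists n0, forall n, (n0 <= n)%nat ->
    \big[Rplus/0]_(c : {ffun 'I_n -> T} |
        Rlt_dec (INR n * (\rsum_t p t * phi t + delta)) (\rsum_j phi (c j))) iid c <= d.
Proof.
move=> delta0 d0; have [rho [rho01 tail]] := chernoff phi delta0.
have [n0 small] := pow_lt_1_zero rho (Rabs_def1 _ _ (proj2 rho01) ltac:(lra)) d d0.
exists n0 => n nn0; apply: Rle_trans (tail n) _.
have := small n ltac:(by apply/leP); move=> /Rabs_def2; lra.
Qed.

Lemma log2_prob_iid (n : nat) (V W : eqType) (f : T -> W) (X : {ffun 'I_n -> T} -> V) c :
  (forall x x', (X x == X x') = [forall j, f (x j) == f (x' j)]) -> 0 < iid c ->
  log2 (prob_eq (@iid n) X (X c)) = \rsum_j log2 (prob_eq p f (f (c j))).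
Proof.
move=> Xf c0.
rewrite (@prob_eq_prod_law _ _ (fun=> p) _ (fun=> W) (fun=> f) X Xf) log2_prod // => j.
exact: Rlt_le_trans (prod_law_gt0 (fun=> p_pmf) j c0) (prob_eq_ge p_pmf f (c j)).
Qed.

End Tail.

Lemma le_Rpower_of_log2 x y : 0 < y -> x <= log2 y -> Rpower 2 x <= y.
Proof.
move=> y0 h; rewrite -(Rpower_log2 y0); apply: Rle_Rpower; lra.
Qed.

Lemma Rpower2_gt0 x : 0 < Rpower 2 x. Proof. exact: exp_pos. Qed.

Lemma Rpower2_small (delta d : R) : 0 < delta -> 0 < d ->
  exists n0, forall n, (n0 <= n)%nat -> Rpower 2 (- (INR n * delta)) <= d.
Proof.
move=> delta0 d0; have [n0 h0] := INR_unbounded (- log2 d / delta).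
exists n0 => n nn0; apply: le_Rpower_of_log2 => //.
have nR : INR n0 <= INR n by apply: le_INR; apply/leP.
have : - log2 d < INR n * delta.
  have -> : - log2 d = - log2 d / delta * delta by field; lra.
  by apply: Rmult_lt_compat_r; lra.
lra.
Qed.

(** Each accepted value carries at least a fraction [theta] of the total mass. *)
Lemma card_heavy (V : finType) (S : pred V) (mass : V -> R) (theta c : R) :
  0 < theta -> 0 < c -> (forall v, 0 <= mass v) -> \rsum_v mass v <= c ->
  (forall v, S v -> theta * c <= mass v) -> INR #|[pred v | S v]| <= / theta.
Proof.
move=> t0 c0 m0 mc Sm.
have : INR #|[pred v | S v]| * (theta * c) <= c.
  apply: Rle_trans mc; rewrite -rsum_indicator big_distrl /=.
  apply: rsum_le => v _; case: ifP => [/Sm|_]; first lra.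
  by rewrite Rmult_0_l.
move=> h; apply: (Rmult_le_reg_r (theta * c)); first exact: Rmult_lt_0_compat.
by have -> : / theta * (theta * c) = c by field; lra.
Qed.

Section PairCoding.
Variables (Y Z : finType) (p : (Y * Z)%type -> R) (p_pmf : is_pmf p).

Definition lefts n (c : {ffun 'I_n -> (Y * Z)%type}) : {ffun 'I_n -> Y} := [ffun j => (c j).1].
Definition rights n (c : {ffun 'I_n -> (Y * Z)%type}) : {ffun 'I_n -> Z} := [ffun j => (c j).2].

Let both n (c : {ffun 'I_n -> (Y * Z)%type}) := (lefts c, rights c).

Let leftsE n (x x' : {ffun 'I_n -> (Y * Z)%type}) :
  (lefts x == lefts x') = [forall j, (x j).1 == (x' j).1].
Proof.
apply/eqP/forallP => [/ffunP E j|E]; first by have := E j; rewrite !ffunE => ->.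
by apply/ffunP => j; rewrite !ffunE; apply/eqP.
Qed.

Let rightsE n (x x' : {ffun 'I_n -> (Y * Z)%type}) :
  (rights x == rights x') = [forall j, (x j).2 == (x' j).2].
Proof.
apply/eqP/forallP => [/ffunP E j|E]; first by have := E j; rewrite !ffunE => ->.
by apply/ffunP => j; rewrite !ffunE; apply/eqP.
Qed.

Let bothE n (x x' : {ffun 'I_n -> (Y * Z)%type}) :
  (both x == both x') = [forall j, ((x j).1, (x j).2) == ((x' j).1, (x' j).2)].
Proof.
rewrite /both xpair_eqE leftsE rightsE.
apply/andP/forallP => [[/forallP E1 /forallP E2] j|E]; first by rewrite xpair_eqE E1 E2.
by split; apply/forallP => j; have := E j; rewrite xpair_eqE => /andP[].
Qed.

Let pY (t : (Y * Z)%type) := prob_eq p (@fst Y Z) t.1.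
Let pZ (t : (Y * Z)%type) := prob_eq p (@snd Y Z) t.2.
Let pYZ (t : (Y * Z)%type) := prob_eq p (fun t : (Y * Z)%type => (t.1, t.2)) (t.1, t.2).
Let HZ := entropy p (@snd Y Z).
Let HZY := entropy p (fun t : (Y * Z)%type => (t.1, t.2)) - entropy p (@fst Y Z).

(** Minus the logarithm of the conditional probability of a block is a sum of i.i.d. terms of mean
    [HZY], so failing the test is a tail event. *)
Let not_heavy_given_left delta n c :
  0 < iid p c ->
  prob_eq (@iid _ p n) (@both n) (both c) <
    Rpower 2 (- (INR n * (HZY + delta))) * prob_eq (@iid _ p n) (@lefts n) (lefts c) ->
  INR n * (\rsum_t p t * (log2 (pY t) - log2 (pYZ t)) + delta) <
    \rsum_j (log2 (pY (c j)) - log2 (pYZ (c j))).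
Proof.
move=> c0 lt.
have P1 : 0 < prob_eq (@iid _ p n) (@both n) (both c).
  exact: Rlt_le_trans c0 (prob_eq_ge (iid_pmf p_pmf n) (@both n) c).
have P2 : 0 < prob_eq (@iid _ p n) (@lefts n) (lefts c).
  exact: Rlt_le_trans c0 (prob_eq_ge (iid_pmf p_pmf n) (@lefts n) c).
have := ln_increasing _ _ P1 lt => lt'.
have {lt'} : log2 (prob_eq (@iid _ p n) (@both n) (both c)) <
  log2 (Rpower 2 (- (INR n * (HZY + delta))) * prob_eq (@iid _ p n) (@lefts n) (lefts c)).
  by apply: Rmult_lt_compat_r lt'; apply: Rinv_0_lt_compat; exact: ln2_gt0.
rewrite log2M //; last exact: Rpower2_gt0.
rewrite log2_Rpower.
rewrite (log2_prob_iid p_pmf (f := fun t => (t.1, t.2)) (@bothE n) c0).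
rewrite (log2_prob_iid p_pmf (f := @fst Y Z) (@leftsE n) c0).
have -> : \rsum_j (log2 (pY (c j)) - log2 (pYZ (c j))) =
    \rsum_j log2 (pY (c j)) - \rsum_j log2 (pYZ (c j)).
  by rewrite /Rminus big_split /= rsumN.
have -> : \rsum_t p t * (log2 (pY t) - log2 (pYZ t)) = HZY.
  rewrite /HZY !entropyE /Rminus Ropp_involutive Rplus_comm -rsumN -big_split /=.
  by apply: eq_bigr => t _; rewrite /pY /pYZ; ring.
set sY := \rsum_j log2 (pY (c j)); set sYZ := \rsum_j log2 (pYZ (c j)) => h.
have {}h : sYZ < - (INR n * (HZY + delta)) + sY := h.
by clearbody sY sYZ; lra.
Qed.

Let not_heavy_right delta n c :
  0 < iid p c ->
  prob_eq (@iid _ p n) (@rights n) (rights c) < Rpower 2 (- (INR n * (HZ + delta))) ->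
  INR n * (\rsum_t p t * (- log2 (pZ t)) + delta) < \rsum_j (- log2 (pZ (c j))).
Proof.
move=> c0 lt.
have P1 : 0 < prob_eq (@iid _ p n) (@rights n) (rights c).
  exact: Rlt_le_trans c0 (prob_eq_ge (iid_pmf p_pmf n) (@rights n) c).
have := ln_increasing _ _ P1 lt => lt'.
have {lt'} : log2 (prob_eq (@iid _ p n) (@rights n) (rights c)) <
  log2 (Rpower 2 (- (INR n * (HZ + delta)))).
  by apply: Rmult_lt_compat_r lt'; apply: Rinv_0_lt_compat; exact: ln2_gt0.
rewrite log2_Rpower.
rewrite (log2_prob_iid p_pmf (f := @snd Y Z) (@rightsE n) c0).
have -> : \rsum_t p t * (- log2 (pZ t)) = HZ.
  rewrite /HZ entropyE -rsumN; apply: eq_bigr => t _; rewrite /pZ; ring.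
rewrite rsumN; set sZ := \rsum_j log2 (pZ (c j)) => h.
have {}h : sZ < - (INR n * (HZ + delta)) := h.
by clearbody sZ; lra.
Qed.

(** The tests accept at most 2^(n (H(Z|Y) + delta)) and 2^(n (H(Z) + delta)) sequences. As [r] is at
    most the mutual information, [A] exceeds the first number, and [A * L] the second, by a factor
    2^(n delta). The four shares [d / 4] go to two atypicality and two collision terms. *)
Lemma pair_coding (r delta d : R) :
  r <= mutinfo p (@fst Y Z) (@snd Y Z) -> 0 < delta -> 0 < d ->
  exists n0, forall n, (n0 <= n)%nat -> forall A L : nat, (0 < A)%nat -> (0 < L)%nat ->
    INR n * (entropy p (@snd Y Z) - r + 2 * delta) <= log2 (INR A) ->
    INR n * r <= log2 (INR L) ->
    exists (f g : {ffun 'I_n -> Z} -> nat)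
      (dec1 : {ffun 'I_n -> Y} -> nat -> {ffun 'I_n -> Z}) (dec2 : nat -> nat -> {ffun 'I_n -> Z}),
    [/\ (forall z, (f z < A)%nat), (forall z, (g z < L)%nat) &
      \rsum_(c | dec1 (lefts c) (f (rights c)) != rights c) iid p c +
      \rsum_(c | dec2 (f (rights c)) (g (rights c)) != rights c) iid p c <= d].
Proof.
move=> rI delta0 d0.
have d4 : 0 < d / 4 by lra.
have [n1 tail1] := iid_tail p_pmf (fun t => log2 (pY t) - log2 (pYZ t)) delta0 d4.
have [n2 tail2] := iid_tail p_pmf (fun t => - log2 (pZ t)) delta0 d4.
have [n3 small] := Rpower2_small delta0 d4.
exists (n1 + n2 + n3)%nat => n nn A L A0 L0 hA hL.
have {}tail1 := tail1 n ltac:(lia); have {}tail2 := tail2 n ltac:(lia).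
have {}small := small n ltac:(lia).
have rA : 0 < INR A by apply: lt_0_INR; apply/ltP.
have rL : 0 < INR L by apply: lt_0_INR; apply/ltP.
have Ppmf := iid_pmf p_pmf n.
pose th1 := Rpower 2 (- (INR n * (HZY + delta))).
pose th2 := Rpower 2 (- (INR n * (HZ + delta))).
(* For [u] of probability zero the threshold would vanish and every [v] would pass; the guard makes
   the list empty instead. *)
pose S1 u v : bool := Rlt_dec 0 (prob_eq (@iid _ p n) (@lefts n) u) &&
  Rle_dec (th1 * prob_eq (@iid _ p n) (@lefts n) u) (prob_eq (@iid _ p n) (@both n) (u, v)).
pose S2 v : bool := Rle_dec th2 (prob_eq (@iid _ p n) (@rights n) v).
have S1N u : INR #|[pred v | S1 u v]| <= / th1.
  have [u0|nu] := Rlt_dec 0 (prob_eq (@iid _ p n) (@lefts n) u); last first.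
    rewrite eq_card0; first by left; apply: Rinv_0_lt_compat; exact: Rpower2_gt0.
    by move=> v; rewrite inE /S1; case: Rlt_dec.
  apply: (@card_heavy _ (S1 u) (fun v => prob_eq (@iid _ p n) (@both n) (u, v)) th1 _ (Rpower2_gt0 _) u0).
  - by move=> v; apply: prob_eq_ge0.
  - right; rewrite [RHS]prob_eqE (partition_big (@rights n) predT) //=.
    by apply: eq_bigr => v _; rewrite prob_eqE; apply: eq_bigl => c; rewrite /both xpair_eqE.
  - by move=> v; rewrite /S1 => /andP[_]; case: Rle_dec.
have S2N : INR #|[pred v | S2 v]| <= / th2.
  apply: (@card_heavy _ S2 (prob_eq (@iid _ p n) (@rights n)) th2 1 (Rpower2_gt0 _)); first lra.
  - by move=> v; apply: prob_eq_ge0.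
  - by rewrite sum_prob_eq //; lra.
  - by move=> v; rewrite /S2 Rmult_1_r; case: Rle_dec.
have [f [g [dec1 [dec2 [fA gL err]]]]] :=
  binning Ppmf (@lefts n) (@rights n) A0 L0 S1N S2N.
exists f, g, dec1, dec2; split=> //; apply: Rle_trans err _.
have e1 : \rsum_(c | ~~ S1 (lefts c) (rights c)) (@iid _ p n) c <= d / 4.
  apply: Rle_trans tail1; rewrite big_mkcond [X in _ <= X]big_mkcond; apply: rsum_le => c _.
  have [c0|<-] := proj1 Ppmf c; last by do 2!case: ifP; lra.
  case: ifP => [|_]; last by case: ifP; lra.
  rewrite /S1; case: Rlt_dec => [_|[]] /=; last first.
    exact: Rlt_le_trans c0 (prob_eq_ge Ppmf (@lefts n) c).
  case: Rle_dec => //= /Rnot_le_lt h _.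
  by case: Rlt_dec => [_|[]] /=; [exact: Rle_refl|exact: not_heavy_given_left].
have e2 : \rsum_(c | ~~ S2 (rights c)) (@iid _ p n) c <= d / 4.
  apply: Rle_trans tail2; rewrite big_mkcond [X in _ <= X]big_mkcond; apply: rsum_le => c _.
  have [c0|<-] := proj1 Ppmf c; last by do 2!case: ifP; lra.
  case: ifP => [|_]; last by case: ifP; lra.
  rewrite /S2; case: Rle_dec => //= /Rnot_le_lt h _.
  by case: Rlt_dec => [_|[]] /=; [exact: Rle_refl|exact: not_heavy_right].
have thV x : / Rpower 2 (- x) = Rpower 2 x by rewrite Rpower_Ropp Rinv_inv.
have n0 := pos_INR n.
have e3 : / th1 / INR A <= d / 4.
  apply: Rle_trans small; rewrite /th1 thV; apply: (Rmult_le_reg_r (INR A)) => //.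
  have -> : Rpower 2 (INR n * (HZY + delta)) / INR A * INR A = Rpower 2 (INR n * (HZY + delta)).
    by field; lra.
  apply: (@Rle_trans _ (Rpower 2 (- (INR n * delta)) * Rpower 2 (INR n * (HZY + 2 * delta)))).
    by rewrite -Rpower_plus; right; congr Rpower; ring.
  apply: Rmult_le_compat_l; first by left; exact: Rpower2_gt0.
  apply: le_Rpower_of_log2 => //; apply: Rle_trans hA; apply: Rmult_le_compat_l => //.
  suff : mutinfo p (@fst Y Z) (@snd Y Z) = HZ - HZY by move: rI; rewrite -/HZ; lra.
  rewrite /HZY; set e := entropy p (fun t => (t.1, t.2)).
  by change (entropy p (@fst Y Z) + HZ - e = HZ - (e - entropy p (@fst Y Z))); ring.
have e4 : / th2 / (INR A * INR L) <= d / 4.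
  have AL : 0 < INR A * INR L by exact: Rmult_lt_0_compat.
  apply: Rle_trans small; rewrite /th2 thV; apply: (Rmult_le_reg_r (INR A * INR L)) => //.
  have -> : Rpower 2 (INR n * (HZ + delta)) / (INR A * INR L) * (INR A * INR L)
     = Rpower 2 (INR n * (HZ + delta)) by field; lra.
  apply: (@Rle_trans _ (Rpower 2 (- (INR n * delta)) * Rpower 2 (INR n * (HZ + 2 * delta)))).
    by rewrite -Rpower_plus; right; congr Rpower; ring.
  apply: Rmult_le_compat_l; first by left; exact: Rpower2_gt0.
  apply: le_Rpower_of_log2 => //; rewrite log2M //.
  have {}hA : INR n * (HZ - r + 2 * delta) <= log2 (INR A) := hA.
  by lra.
by lra.
Qed.

End PairCoding.

(** * Achievability *)

Lemma entropy_ord_lt (Om : finType) (P : Om -> R) (Ppmf : is_pmf P) (N : nat)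
    (X : Om -> 'I_N) (B : nat) :
  (forall w, (X w < B)%nat) -> entropy P X <= log2 (INR B).
Proof.
move=> XB; rewrite (@entropy_ker _ P _ _ X (fun w => Ordinal (XB w))).
  by apply: Rle_trans (entropy_card Ppmf _) _; rewrite card_ord; exact: Rle_refl.
by move=> w w'; rewrite -!val_eqE.
Qed.

Lemma entropy_map_le (Om : finType) (P : Om -> R) (Ppmf : is_pmf P) (I : Type)
    (VB : eqType) (VC : finType) (B : Om -> VB) (C : I -> Om -> VC) (s : list I) :
  entropy P (fun w => (B w, seq.map (fun i => C i w) s)) <=
  entropy P B + \rsum_(i <- s) entropy P (C i).
Proof.
elim: s => [|i s IH].
  rewrite big_nil Rplus_0_r; right; apply: entropy_ker => w w'.
  by rewrite xpair_eqE andbT.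
rewrite big_cons; have := entropy_pair_le Ppmf (C i) (fun w => (B w, seq.map (fun i => C i w) s)).
rewrite (@entropy_ker _ P _ _ (fun w => (C i w, _)) (fun w => (B w, seq.map (fun i => C i w) (i :: s)))).
  by move=> h; lra.
by move=> w w'; rewrite !xpair_eqE /= eqseq_cons; do !case: (_ == _).
Qed.

Lemma union_bound (Om I : finType) (P : Om -> R) (P0 : forall w, 0 <= P w) (E : I -> pred Om) :
  \big[Rplus/0]_(w | ~~ [forall i, E i w]) P w <= \rsum_i \rsum_(w | ~~ E i w) P w.
Proof.
under [X in _ <= X]eq_bigr => i _ do rewrite big_mkcond /=.
rewrite exchange_big /= big_mkcond; apply: rsum_le => w _.
have ge0 i : true -> 0 <= if ~~ E i w then P w else 0 by case: ifP => _ _ //; lra.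
case: ifP => [/forallPn [i Ei]|_]; last exact: rsum_ge0.
have := @rsum_ge_term _ xpredT (fun i => if ~~ E i w then P w else 0) i (fun i => ge0 i isT) isT.
by rewrite Ei.
Qed.

Lemma INR_foldr_muln (I : Type) (F : I -> nat) (s : list I) :
  INR (foldr muln 1%nat (seq.map F s)) = \big[Rmult/1]_(i <- s) INR (F i).
Proof.
by elim: s => [|i s IH]; rewrite ?big_nil ?big_cons //= -IH -mult_INR.
Qed.

Lemma log2_expn (m n : nat) : (0 < m)%nat -> log2 (INR (expn m n)) = INR n * log2 (INR m).
Proof.
move=> m0; have rm : 0 < INR m by apply: lt_0_INR; apply/ltP.
elim: n => [|n IH]; first by rewrite expn0 log2_1 Rmult_0_l.
have rmn : 0 < INR (expn m n) by apply: lt_0_INR; apply/ltP; rewrite expn_gt0 m0.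
by rewrite expnS mult_INR log2M // IH S_INR; ring.
Qed.

(** Rounding 2^x up to an integer at most doubles it, since [x >= 0]: one bit. *)
Lemma exists_nat_log2 (x : R) : 0 <= x ->
  exists N : nat, (0 < N)%nat /\ x <= log2 (INR N) <= x + 1.
Proof.
move=> x0; have y1 : 1 <= Rpower 2 x.
  by rewrite -(Rpower_O 2); [apply: Rle_Rpower|]; lra.
have [up1 up2] := archimed (Rpower 2 x).
have zpos : (0 <= up (Rpower 2 x))%Z by apply: le_IZR; lra.
have NE : INR (Z.to_nat (up (Rpower 2 x))) = IZR (up (Rpower 2 x)).
  by rewrite INR_IZR_INZ Znat.Z2Nat.id.
exists (Z.to_nat (up (Rpower 2 x))); rewrite NE; split.
  by apply/ltP; apply: INR_lt; rewrite NE /=; lra.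
split; first by rewrite -{1}(log2_Rpower x); apply: log2_le; lra.
have -> : x + 1 = log2 (Rpower 2 x * 2) by rewrite log2M ?log2_Rpower ?log2_2; lra.
by apply: log2_le; lra.
Qed.

Section Columns.
Variables (M : nat) (Y Z : 'I_M -> bool -> finType).
Variable p : forall i a, (Y i a * Z i a)%type -> R.
Hypothesis hp : forall i a, is_pmf (@p i a).
Variable n : nat.

Definition column (k : 'I_M * bool) (xs : src Y Z n) : {ffun 'I_n -> (Y k.1 k.2 * Z k.1 k.2)%type} :=
  [ffun j => xs j k].

Lemma iid_column k c :
  iid (@p k.1 k.2) c = \rsum_(xs | column k xs == c) src_pmf p xs.
Proof.
rewrite (eq_bigl (fun xs : src Y Z n => [forall j, xs j k == c j])); last first.
  move=> xs; apply/eqP/forallP => [/ffunP E j|E]; first by have := E j; rewrite !ffunE => ->.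
  by apply/ffunP => j; rewrite !ffunE; apply/eqP.
rewrite (eq_bigr _ (fun xs _ => src_pmfE p xs)).
rewrite (@prod_law_agree 'I_n (fun=> letter M Y Z) (fun=> letter_pmf p) (fun j x => x k == c j)).
rewrite /iid /prod_law; apply: eq_bigr => j _.
rewrite (eq_bigr _ (fun x _ => letter_pmfE p x)).
have := @prod_law_marginal _ _ (@pair_pmf M Y Z p) (fun k => hp k.1 k.2) k
  (fun t => if t == c j then 1 else 0).
rewrite [X in X = _ -> _](eq_bigr (fun x : letter M Y Z => if x k == c j then prod_law (@pair_pmf M Y Z p) x else 0)); last first.
  by move=> x _; case: ifP => _; lra.
rewrite -big_mkcond /= => ->.
rewrite (eq_bigr (fun t => if t == c j then p t else 0)); last first.
  by move=> t _; rewrite /pair_pmf; case: ifP => _; lra.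
by rewrite rsum_pick.
Qed.

Lemma agree_lefts k (xs xs' : src Y Z n) :
  (forall j, (xs j k).1 = (xs' j k).1) -> lefts (column k xs) = lefts (column k xs').
Proof. by move=> E; apply/ffunP => j; rewrite !ffunE E. Qed.

Lemma agree_rights k (xs xs' : src Y Z n) :
  (forall j, (xs j k).2 = (xs' j k).2) -> rights (column k xs) = rights (column k xs').
Proof. by move=> E; apply/ffunP => j; rewrite !ffunE E. Qed.

End Columns.

(** * The coding scheme and its secrecy *)

Section Scheme.
Variables (M : nat) (Y Z : 'I_M -> bool -> finType).
Variable p : forall i a, (Y i a * Z i a)%type -> R.
Hypothesis hp : forall i a, is_pmf (@p i a).
Variables (m0 : 'I_M) (n : nat) (A : 'I_M * bool -> nat) (L : 'I_M -> nat).
Hypothesis L_gt0 : forall i, (0 < L i)%nat.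

Local Notation srcT := (src Y Z n).
Local Notation Yn k := {ffun 'I_n -> Y k.1 k.2}.
Local Notation Zn k := {ffun 'I_n -> Z k.1 k.2}.

Variables (f g : forall k : 'I_M * bool, Zn k -> nat).
Variables (dec1 : forall k : 'I_M * bool, Yn k -> nat -> Zn k)
          (dec2 : forall k : 'I_M * bool, nat -> nat -> Zn k).
Hypothesis f_lt : forall k z, (@f k z < A k)%nat.
Hypothesis g_lt : forall k z, (@g k z < L k.1)%nat.

Definition zcol k (xs : srcT) : Zn k := rights (column k xs).
Definition ycol k (xs : srcT) : Yn k := lefts (column k xs).

(** No terminal runs [dec2]: it enters the secrecy count, where bin and key must reveal the
    source. *)
Definition good (xs : srcT) : bool := [forall k,
  (dec1 (ycol k xs) (f (zcol k xs)) == zcol k xs) &&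
  (dec2 k (f (zcol k xs)) (g (zcol k xs)) == zcol k xs)].

Definition pkey k (xs : srcT) : nat := g (zcol k xs).

(** A code has one message alphabet for all rounds; this number bounds every bin index and every
    residue. *)
Definition msg_bound : nat := ((\sum_k A k) + \sum_i L i)%nat.
Local Notation N := msg_bound.
Definition msgT : finType := ('I_N.+1 * 'I_N.+1 * 'I_N.+1)%type.

(* Relay [i] publishes the bins of its two sources and the sum of its two pairwise keys. *)
Definition msg (i : 'I_M) (xs : srcT) : msgT :=
  (inord (f (zcol (i, true) xs)), inord (f (zcol (i, false) xs)),
   inord ((pkey (i, true) xs + pkey (i, false) xs) %% L i)).

(** [M] rounds suffice: they are exactly the turns of the relays, before Alice and Bob would first
    speak. *)
Definition transcript (xs : srcT) : M.-tuple 'I_#|msgT| :=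
  [tuple enum_rank (msg l xs) | l < M].

Definition heard (fs : M.-tuple 'I_#|msgT|) (i : 'I_M) : msgT := enum_val (tnth fs i).

Definition keyT : finType := {dffun forall i : 'I_M, 'I_(if i == m0 then 0 else (L i).-1)%nat.+1}.

(* The key masks the common part of relay [i] with that of [m0], for every [i <> m0];
   coordinate [m0] of [keyT] is trivial. *)
Definition star_key (T : 'I_M -> nat) : keyT := [ffun i => inord ((T i + T m0) %% L i)].

Definition alice_common (xs : srcT) fs (i : 'I_M) : nat :=
  g (dec1 (ycol (i, true) xs) (heard fs i).1.1).

(** Bob subtracts his own key from the published sum; [L i] is added first because subtraction on
    naturals truncates. *)
Definition bob_common (xs : srcT) fs (i : 'I_M) : nat :=
  ((heard fs i).2 + (L i - g (dec1 (ycol (i, false) xs) (heard fs i).1.2))) %% L i.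

Definition scheme : code Y Z n M #|msgT| #|keyT| := {|
  enc l xs pre x := if x == enum_rank (msg l xs) then 1 else 0;
  keyA xs fs := enum_rank (star_key (alice_common xs fs));
  keyB xs fs := enum_rank (star_key (bob_common xs fs)) |}.

Lemma eq_star_key T T' : (forall i, T i = T' i) -> star_key T = star_key T'.
Proof. by move=> E; apply/ffunP => i; rewrite !ffunE !E. Qed.

Lemma star_keyP T i : i != m0 -> nat_of_ord (star_key T i) = ((T i + T m0) %% L i)%nat.
Proof.
move=> im; rewrite ffunE inordK // (negbTE im) prednK //.
exact: ltn_pmod.
Qed.

Lemma eq_msg i (xs xs' : srcT) : (forall a, zcol (i, a) xs = zcol (i, a) xs') ->
  msg i xs = msg i xs'.
Proof. by move=> E; rewrite /msg /pkey !E. Qed.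

Lemma heard_transcript xs i : heard (transcript xs) i = msg i xs.
Proof. by rewrite /heard tnth_mktuple enum_rankK. Qed.

Lemma scheme_valid : valid_code scheme.
Proof.
split; first by move=> l xs pre x /=; case: ifP; lra.
split; first by move=> l xs pre; rewrite sumRE /= rsum_pick.
split.
  move=> l xs xs' pre x; rewrite /transmitter_agree /=.
  have lM := ltn_ord l.
  rewrite modn_small; last by lia.
  have -> : (l.+1 == M.+1) = false by apply/eqP; lia.
  move=> /(_ l erefl) E; rewrite (@eq_msg l xs xs') // => a.
  by apply: agree_rights => j; exact: E.
split=> xs xs' fs E /=; congr enum_rank; apply: eq_star_key => i.
  by rewrite /alice_common /ycol (agree_lefts (k := (i, true)) (fun j => E j i)).
by rewrite /bob_common /ycol (agree_lefts (k := (i, false)) (fun j => E j i)).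
Qed.

Let A_le k : (A k <= N)%nat.
Proof. by rewrite /N (bigD1 k) //= -addnA leq_addr. Qed.

Let L_le i : (L i <= N)%nat.
Proof. by rewrite /N [X in (_ + X)%nat](bigD1 i) //= addnCA leq_addr. Qed.

Let fK k z : nat_of_ord (inord (@f k z) : 'I_N.+1) = f z.
Proof. by rewrite inordK // ltnS; apply: leq_trans (A_le k); exact: ltnW. Qed.

Let sumK (x : nat) i : nat_of_ord (inord (x %% L i) : 'I_N.+1) = (x %% L i)%nat.
Proof. by rewrite inordK // ltnS; apply: leq_trans (L_le i); apply: ltnW; exact: ltn_pmod. Qed.

Lemma alice_good xs i : good xs -> alice_common xs (transcript xs) i = pkey (i, true) xs.
Proof.
move=> /forallP /(_ (i, true)) /andP[/eqP E _].
by rewrite /alice_common heard_transcript /= fK E.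
Qed.

Lemma bob_good xs i : good xs -> bob_common xs (transcript xs) i = pkey (i, true) xs.
Proof.
move=> /forallP /(_ (i, false)) /andP[/eqP E _].
rewrite /bob_common heard_transcript /= fK E sumK /pkey.
have b := g_lt (zcol (i, true) xs); have c := g_lt (zcol (i, false) xs).
rewrite modnDml -addnA subnKC; last exact: ltnW.
by rewrite modnDr modn_small.
Qed.

Definition srcKA xs := keyA scheme xs (transcript xs).
Definition srcKB xs := keyB scheme xs (transcript xs).

Lemma good_agree xs : good xs -> srcKA xs = srcKB xs.
Proof.
move=> G; rewrite /srcKA /srcKB /=; congr enum_rank; apply: eq_star_key => i.
by rewrite alice_good // bob_good.
Qed.

(** The encoders are deterministic, so the joint law sits on the graph of [transcript] and all
    entropies can be computed on the source. *)
Lemma transcript_push (w : Omega Y Z n M #|msgT|) :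
  joint_pmf p scheme w = \rsum_(xs | (xs, transcript xs) == w) src_pmf p xs.
Proof.
case: w => x fs; rewrite joint_pmfE /transcript_prob /=.
have [->|ne] := eqVneq fs (transcript x).
  rewrite (big_pred1 x); last first.
    move=> xs; apply/eqP/eqP => [[->//]|->//].
  rewrite big1 ?Rmult_1_r // => l _.
  by rewrite tnth_mktuple eqxx.
rewrite [RHS]big_pred0; last first.
  by move=> xs; apply/negP => /eqP[xx E]; rewrite -E xx eqxx in ne.
have [l nl] : exists l, tnth fs l != enum_rank (msg l x).
  apply/existsP; apply: contra_neqT ne => /existsPn h; apply: eq_from_tnth => l.
  by rewrite tnth_mktuple; apply/eqP; have := h l; rewrite negbK.
by rewrite (bigD1 l) //= (negbTE nl) Rmult_0_l Rmult_0_r.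
Qed.

(** The part of [T_m0] lost in coordinate [m] of the key, which shows it only modulo [L m] to a
    relay knowing [T_m]. *)
Definition aux (m : 'I_M) (xs : srcT) : 'I_(L m0 %/ L m).+1 :=
  inord (pkey (m0, true) xs %/ L m).

Definition relays_mask : mask M := fun=> (false, true).

(** The view of [m] gives [T_m], coordinate [m] of the key then gives [T_m0] modulo [L m], and [aux]
    completes it; if [m = m0] the view gives [T_m0] at once. The other coordinates yield every
    [T_i], the published sums yield the second pairwise keys, and bins with keys yield the sources
    through [dec2]. *)
Lemma scheme_determines m xs xs' : good xs -> good xs' ->
  aux m xs = aux m xs' -> srcKA xs = srcKA xs' ->
  obs (relay_mask m) xs = obs (relay_mask m) xs' -> transcript xs = transcript xs' ->
  obs relays_mask xs = obs relays_mask xs'.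
Proof.
move=> G G' Eaux EK Eobs Etr.
pose a i := pkey (i, true) xs; pose a' i := pkey (i, true) xs'.
pose b i := pkey (i, false) xs; pose b' i := pkey (i, false) xs'.
have aL i : (a i < L i)%nat by exact: g_lt.
have aL' i : (a' i < L i)%nat by exact: g_lt.
have bL i : (b i < L i)%nat by exact: g_lt.
have bL' i : (b' i < L i)%nat by exact: g_lt.
have SK : star_key a = star_key a'.
  move: EK; rewrite /srcKA /= => /enum_rank_inj E.
  rewrite (@eq_star_key a (alice_common xs (transcript xs))); last first.
    by move=> j; rewrite alice_good.
  by rewrite E; apply: eq_star_key => j; rewrite alice_good.
have key i : i != m0 -> ((a i + a m0) %% L i = (a' i + a' m0) %% L i)%nat.
  by move=> im; rewrite -!star_keyP // SK.
have am : a m = a' m.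
  rewrite /a /a' /pkey /zcol (agree_rights (k := (m, true)) (xs' := xs')) // => j.
  by have /obs_eq/(_ j (m, true)) [_] := Eobs; apply => /=.
have am0 : a m0 = a' m0.
  have [<- //|mm] := eqVneq m m0.
  have /eqP := key m mm; rewrite am eqn_modDl => /eqP Emod.
  have Ediv : (a m0 %/ L m = a' m0 %/ L m)%nat.
    have := congr1 (@nat_of_ord _) Eaux; rewrite /aux !inordK //.
      by rewrite ltnS; apply: leq_div2r; exact: ltnW (aL' m0).
    by rewrite ltnS; apply: leq_div2r; exact: ltnW (aL m0).
  by rewrite (divn_eq (a m0) (L m)) (divn_eq (a' m0) (L m)) Ediv Emod.
have aE i : a i = a' i.
  have [->//|im] := eqVneq i m0.
  by have /eqP := key i im; rewrite am0 eqn_modDr !modn_small // => /eqP.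
have msgE i : msg i xs = msg i xs' by rewrite -!heard_transcript Etr.
have bE i : b i = b' i.
  have := congr1 (fun z : msgT => nat_of_ord z.2) (msgE i); rewrite /msg /= !sumK.
  rewrite -/(a i) -/(b i) -/(a' i) -/(b' i) aE => /eqP.
  by rewrite eqn_modDl !modn_small // => /eqP.
have zE k : zcol k xs = zcol k xs'.
  have /forallP /(_ k) /andP[_ /eqP E] := G; have /forallP /(_ k) /andP[_ /eqP E'] := G'.
  rewrite -E -E'; case: k {E E'} => i [].
    have := congr1 (fun z : msgT => nat_of_ord z.1.1) (msgE i); rewrite /msg /= !fK => ->.
    by rewrite (aE i : g (zcol (i, true) xs) = g (zcol (i, true) xs')).
  have := congr1 (fun z : msgT => nat_of_ord z.1.2) (msgE i); rewrite /msg /= !fK => ->.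
  by rewrite (bE i : g (zcol (i, false) xs) = g (zcol (i, false) xs')).
apply/obs_eq => j k /=; split=> // _.
by have := zE k => /ffunP /(_ j); rewrite !ffunE.
Qed.

Lemma log2_card_key :
  log2 (INR #|keyT|) = \rsum_i (if i == m0 then 0 else log2 (INR (L i))).
Proof.
rewrite card_dep_ffun.
rewrite (INR_foldr_muln (fun i => #|'I_(if i == m0 then 0 else (L i).-1)%nat.+1|)).
rewrite big_enum /= log2_prod => [|i]; last by rewrite card_ord; apply: lt_0_INR; apply/ltP.
apply: eq_bigr => i _; rewrite card_ord; case: ifP => _; first exact: log2_1.
by rewrite prednK.
Qed.

Let P := @src_pmf M Y Z p n.
Let Ppmf : is_pmf P := src_pmf_pmf hp n.

Definition log_alphabet : R := log2 (INR #|{dffun forall k, viewT Y Z k}|).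

(** Fano's inequality with all relay sources as the unknown; [aux] is charged the logarithm of its
    alphabet. *)
Lemma key_equivocation_ge m eta : 0 < eta < 1 ->
  \rsum_(xs | ~~ good xs) P xs <= eta ->
  entropy P (obs relays_mask) <=
  entropy P (fun xs => (srcKA xs, (obs (relay_mask m) xs, transcript xs)))
  + log2 (INR (L m0 %/ L m).+1) + fano_bound eta + eta * (INR n * log_alphabet).
Proof.
move=> eta01 bad.
pose E xs := (srcKA xs, (obs (relay_mask m) xs, transcript xs)).
pose aE xs := (aux m xs, E xs); pose raE xs := (obs relays_mask xs, aE xs).
have h1 : entropy P aE <= entropy P E + log2 (INR (L m0 %/ L m).+1).
  by have := entropy_pair_card Ppmf (aux m) E; rewrite card_ord.
have D0 : (0 < #|{dffun forall k, viewT Y Z k}|)%nat.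
  have [x0 _] := pmf_inhabited (letter_pmf_pmf hp); apply/card_gt0P.
  by exists [ffun k => view (true, true) (x0 k)].
have h2 : entropy P raE <= entropy P aE + fano_bound eta + eta * (INR n * log_alphabet).
  have := @fano _ P Ppmf _ _ (obs relays_mask) aE good eta eta01 bad.
  rewrite card_ffun card_ord log2_expn //; apply=> xs xs' G G' e.
  exact: (scheme_determines G G' (congr1 (fun z => z.1) e) (congr1 (fun z => z.2.1) e)
    (congr1 (fun z => z.2.2.1) e) (congr1 (fun z => z.2.2.2) e)).
have h3 : entropy P (obs relays_mask) <= entropy P raE.
  by apply: entropy_le_ref => // w w' [].
by move: h1 h2 h3; rewrite -/E; lra.
Qed.

Lemma entropy_msg_le i :
  entropy P (msg i) <=
  log2 (INR (A (i, true))) + log2 (INR (A (i, false))) + log2 (INR (L i)).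
Proof.
pose m1 xs := (msg i xs).1; pose m2 xs := (msg i xs).2.
pose m11 xs := (m1 xs).1; pose m12 xs := (m1 xs).2.
have h1 : entropy P (msg i) <= entropy P m1 + entropy P m2.
  by apply: Rle_trans (entropy_pair_le Ppmf m1 m2); right; apply: entropy_ker.
have h2 : entropy P m1 <= entropy P m11 + entropy P m12.
  by apply: Rle_trans (entropy_pair_le Ppmf m11 m12); right; apply: entropy_ker.
have b1 : entropy P m11 <= log2 (INR (A (i, true))).
  by apply: entropy_ord_lt => // xs; rewrite /m11 /= fK.
have b2 : entropy P m12 <= log2 (INR (A (i, false))).
  by apply: entropy_ord_lt => // xs; rewrite /m12 /= fK.
have b3 : entropy P m2 <= log2 (INR (L i)).
  by apply: entropy_ord_lt => // xs; rewrite /m2 /= sumK; exact: ltn_pmod.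
by lra.
Qed.

(** The message of [m] is a function of its own observation and adds nothing; every other message is
    charged the logarithms of the actual ranges of its components. *)
Lemma eavesdropper_entropy_le m :
  entropy P (fun xs => (obs (relay_mask m) xs, transcript xs)) <=
  entropy P (obs (relay_mask m)) + \rsum_(i | i != m)
    (log2 (INR (A (i, true))) + log2 (INR (A (i, false))) + log2 (INR (L i))).
Proof.
pose s := [seq i <- enum 'I_M | i != m].
apply: (@Rle_trans _ (entropy P (fun xs =>
    (obs (relay_mask m) xs, seq.map (fun i => msg i xs) s)))).
  apply: entropy_le_ref => // xs xs' [E1 E2]; congr (_, _) => //.
  apply: eq_from_tnth => i; rewrite !tnth_mktuple; congr enum_rank.
  have [->|im] := eqVneq i m.
    apply: eq_msg => a; apply: agree_rights => j.
    by have /obs_eq/(_ j (m, a)) [_] := E1; apply => /=.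
  have /eq_in_map := E2; apply.
  by rewrite mem_filter im mem_enum.
apply: Rle_trans (entropy_map_le Ppmf _ _ _) _; apply: Rplus_le_compat_l.
rewrite /s big_filter big_enum_cond /=; apply: rsum_le => i _.
exact: entropy_msg_le.
Qed.

(** The logarithm of the key alphabet minus the lower bound obtained for the entropy of the key
    given the view of [m]. *)
Definition leak_bound (m : 'I_M) (eta : R) : R :=
  log2 (INR #|keyT|) + log2 (INR (L m0 %/ L m).+1) + fano_bound eta
  + eta * (INR n * log_alphabet)
  + \rsum_(i | i != m) (log2 (INR (A (i, true))) + log2 (INR (A (i, false))) + log2 (INR (L i))
      - INR n * (entropy (@p i true) (@snd _ _) + entropy (@p i false) (@snd _ _))).

Let obs_relays_gap m :
  entropy P (obs relays_mask) - entropy P (obs (relay_mask m)) =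
  \rsum_(i | i != m) (INR n * (entropy (@p i true) (@snd _ _) + entropy (@p i false) (@snd _ _))).
Proof.
rewrite !obs_entropy // -Rmult_minus_distr_l -big_distrr /=; congr (_ * _).
rewrite /Rminus -rsumN -big_split /=.
transitivity (\rsum_i \rsum_(a : bool) (if i != m then entropy (@p i a) (@snd _ _) else 0)).
  rewrite pair_bigA /=; apply: eq_bigr => -[i a] _; rewrite !entropy_view //=.
  by case: (i == m) => /=; lra.
rewrite [RHS]big_mkcond; apply: eq_bigr => i _; rewrite big_bool /=.
by case: (i == m) => /=; lra.
Qed.

(** Both conclusions follow from one bound, H(K | view) >= log|K| - leak: secrecy because H(K) <=
    log|K|, near uniformity because H(K) >= H(K | view). *)
Lemma scheme_secrecy m eta : 0 < eta < 1 ->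
  \rsum_(xs | ~~ good xs) P xs <= eta ->
  let J := joint_pmf p scheme in
  let KA := fun w : Omega Y Z n M #|msgT| => keyA scheme w.1 w.2 in
  mutinfo J KA (fun w : Omega Y Z n M #|msgT| => (relay_obs m w.1, w.2)) <= leak_bound m eta /\
  log2 (INR #|keyT|) - leak_bound m eta <= entropy J KA.
Proof.
move=> eta01 bad J KA.
pose W (w : Omega Y Z n M #|msgT|) := (relay_obs m w.1, w.2).
pose KW w := (KA w, W w).
pose sW xs := (obs (relay_mask m) xs, transcript xs); pose sKW xs := (srcKA xs, sW xs).
have eK : entropy J KA = entropy P srcKA.
  by rewrite -(push_entropy transcript_push KA).
have eW : entropy J W = entropy P sW.
  rewrite -(push_entropy transcript_push W).
  by apply: entropy_ker => xs xs'; rewrite !xpair_eqE relay_obsE.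
have eKW : entropy J KW = entropy P sKW.
  rewrite -(push_entropy transcript_push KW).
  by apply: entropy_ker => xs xs'; rewrite !xpair_eqE relay_obsE.
have hc : entropy P srcKA <= log2 (INR #|keyT|).
  by apply: Rle_trans (entropy_card Ppmf _) _; rewrite card_ord; exact: Rle_refl.
have h4 : entropy P sKW <= entropy P srcKA + entropy P sW := entropy_pair_le Ppmf srcKA sW.
have hI : mutinfo J KA W = entropy P srcKA + entropy P sW - entropy P sKW.
  by rewrite -eK -eW -eKW.
have gap : log2 (INR #|keyT|) - leak_bound m eta <= entropy P sKW - entropy P sW.
  have h1 : entropy P (obs relays_mask) <= entropy P sKW + log2 (INR (L m0 %/ L m).+1)
      + fano_bound eta + eta * (INR n * log_alphabet) := key_equivocation_ge m eta01 bad.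
  pose S := \rsum_(i | i != m)
    (log2 (INR (A (i, true))) + log2 (INR (A (i, false))) + log2 (INR (L i))).
  have h2 : entropy P sW <= entropy P (obs (relay_mask m)) + S := eavesdropper_entropy_le m.
  have h3 := obs_relays_gap m.
  rewrite /leak_bound.
  have -> : \rsum_(i | i != m) (log2 (INR (A (i, true))) + log2 (INR (A (i, false))) + log2 (INR (L i))
      - INR n * (entropy (@p i true) (@snd _ _) + entropy (@p i false) (@snd _ _))) =
      S - (entropy P (obs relays_mask) - entropy P (obs (relay_mask m))).
    by rewrite h3 /Rminus -rsumN -big_split.
  by clearbody S; lra.
by rewrite -/(W) hI eK; split; lra.
Qed.

Lemma scheme_error eta : \rsum_(xs | ~~ good xs) P xs <= eta ->
  sumR (fun w : Omega Y Z n M #|msgT| =>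
    if keyA scheme w.1 w.2 != keyB scheme w.1 w.2 then joint_pmf p scheme w else 0) <= eta.
Proof.
move=> bad; rewrite sumRE -big_mkcond /=.
have := push_event transcript_push (fun w => keyA scheme w.1 w.2 != keyB scheme w.1 w.2).
move=> <-; apply: Rle_trans bad; apply: rsum_pred_le => [xs|xs]; first by case: Ppmf.
by apply: contra => G; apply/eqP; exact: good_agree.
Qed.

Lemma good_prob (d : R) :
  (forall k, \rsum_(c | dec1 (lefts c) (f (rights c)) != rights c) iid (@p k.1 k.2) c +
     \rsum_(c | dec2 k (f (rights c)) (g (rights c)) != rights c) iid (@p k.1 k.2) c <= d) ->
  \rsum_(xs | ~~ good xs) P xs <= INR (M * 2) * d.
Proof.
move=> err; apply: Rle_trans (union_bound (proj1 Ppmf) _) _.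
have -> : INR (M * 2) * d = \rsum_(k : 'I_M * bool) d.
  by rewrite rsum_const card_prod card_ord card_bool.
apply: rsum_le => k _; apply: Rle_trans (err k).
rewrite -(push_event (iid_column hp (k := k)) (fun c => dec1 (lefts c) (f (rights c)) != rights c)).
rewrite -(push_event (iid_column hp (k := k)) (fun c => dec2 k (f (rights c)) (g (rights c)) != rights c)).
rewrite big_mkcond [X in _ <= X + _]big_mkcond [X in _ <= _ + X]big_mkcond -big_split /=.
apply: rsum_le => xs _; have Pxs := proj1 Ppmf xs; rewrite negb_and.
by rewrite /ycol /zcol; do 2!case: (_ == _) => /=; rewrite /P in Pxs *; lra.
Qed.

End Scheme.

Lemma mutinfo_bounds (Y Z : finType) (p : (Y * Z)%type -> R) : is_pmf p ->
  0 <= mutinfo p (@fst Y Z) (@snd Y Z) <= entropy p (@snd Y Z).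
Proof.
move=> pp; rewrite /mutinfo.
pose hY := entropy p (@fst Y Z); pose hZ := entropy p (@snd Y Z).
pose hYZ := entropy p (fun w => (w.1, w.2)).
have h1 : hYZ <= hY + hZ := entropy_pair_le pp (@fst Y Z) (@snd Y Z).
have h2 : hY <= hYZ by apply: entropy_le_ref => // w w' [].
by change (0 <= hY + hZ - hYZ <= hZ); lra.
Qed.

(** * Rates of the scheme *)

Section Rates.
Variables (M : nat) (Y Z : 'I_M -> bool -> finType).
Variable p : forall i a, (Y i a * Z i a)%type -> R.
Hypothesis hp : forall i a, is_pmf (@p i a).
Variables (m0 : 'I_M) (hm0 : forall m, Imin p m <= Imin p m0).

Lemma Imin_bounds i a :
  0 <= Imin p i /\ Imin p i <= pair_mi p i a /\ Imin p i <= entropy (@p i a) (@snd _ _).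
Proof.
have [a1 a2] := mutinfo_bounds (hp i true); have [b1 b2] := mutinfo_bounds (hp i false).
have h : Imin p i <= pair_mi p i a.
  by rewrite /Imin; case: a; [exact: Rmin_l|exact: Rmin_r].
split; first by apply: Rmin_glb.
by split=> //; apply: Rle_trans h _; case: a.
Qed.

Variables (n : nat) (A : 'I_M * bool -> nat) (L : 'I_M -> nat) (delta : R).
Hypothesis delta_gt0 : 0 < delta.
Hypothesis L_gt0 : forall i, (0 < L i)%nat.
Hypothesis L_rate : forall i,
  INR n * Imin p i <= log2 (INR (L i)) <= INR n * Imin p i + 1.
Hypothesis A_rate : forall k,
  log2 (INR (A k)) <= INR n * (entropy (@p k.1 k.2) (@snd _ _) - Imin p k.1 + 2 * delta) + 1.

(** Maximality of [Imin p m0] enters here: [aux] has at least one value, which fits the bound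
    because [x >= 0]. One extra bit pays for the rounding of [L m0], the other for the successor. *)
Lemma log2_quotient m : log2 (INR (L m0 %/ L m).+1) <= INR n * (Imin p m0 - Imin p m) + 2.
Proof.
have n0 := pos_INR n.
have a0 : 0 < INR (L m0) by apply: lt_0_INR; apply/ltP.
have b0 : 0 < INR (L m) by apply: lt_0_INR; apply/ltP.
set x := INR n * (Imin p m0 - Imin p m).
have x0 : 0 <= x by apply: Rmult_le_pos => //; have := hm0 m; lra.
have y1 : 1 <= Rpower 2 x by rewrite -(Rpower_O 2); [apply: Rle_Rpower|]; lra.
have qx : INR (L m0 %/ L m) <= 2 * Rpower 2 x.
  apply: (Rmult_le_reg_r (INR (L m))) => //.
  apply: (@Rle_trans _ (INR (L m0))).
    by rewrite -mult_INR; apply: le_INR; apply/leP; exact: leq_divM.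
  have -> : 2 * Rpower 2 x * INR (L m) = Rpower 2 (1 + x + log2 (INR (L m))).
    by rewrite !Rpower_plus Rpower_1 ?Rpower_log2 //; lra.
  rewrite -{1}(Rpower_log2 a0); apply: Rle_Rpower; first lra.
  have := proj2 (L_rate m0); have := proj1 (L_rate m); rewrite /x; lra.
have -> : x + 2 = log2 (Rpower 2 x * 2 * 2).
  by rewrite !log2M ?log2_Rpower ?log2_2; lra.
by apply: log2_le; rewrite S_INR; have := pos_INR (L m0 %/ L m); lra.
Qed.

Lemma key_rate : INR n * (sumR (Imin p) - Imin p m0) <= log2 (INR #|keyT m0 L|) <=
  INR n * (sumR (Imin p) - Imin p m0) + INR M.
Proof.
rewrite log2_card_key // -sum_except big_distrr /=; split.
  by apply: rsum_le => i _; case: ifP => _; [lra|exact: proj1 (L_rate i)].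
have -> : INR M = \rsum_(i : 'I_M) 1 by rewrite rsum_const card_ord Rmult_1_r.
rewrite -big_split /=; apply: rsum_le => i _.
by case: ifP => _; [lra|exact: proj2 (L_rate i)].
Qed.

(** The terms of order [n] cancel: the key gives sum I - I_m0, the quotient I_m0 - I_m, messages
    less sources -(sum I - I_m). Each relay leaves one bit of key rounding, three of message
    rounding, and [4 * delta] per letter from its two bins. *)
Lemma leak_bound_le m eta :
  leak_bound p m0 n A L m eta <=
  4 * INR M + 2 + fano_bound eta + INR n * (eta * log_alphabet Y Z + 4 * INR M * delta).
Proof.
have n0 := pos_INR n; have nd : 0 <= INR n * delta by nra.
have hk := proj2 key_rate; have hq := log2_quotient m.
set b := 4 * (INR n * delta) + 3.
have hs : \rsum_(i | i != m) (log2 (INR (A (i, true))) + log2 (INR (A (i, false))) + log2 (INR (L i))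
      - INR n * (entropy (@p i true) (@snd _ _) + entropy (@p i false) (@snd _ _))) <=
    INR M * b - INR n * (sumR (Imin p) - Imin p m).
  apply: (@Rle_trans _ (\rsum_(i : 'I_M) (b - INR n * (if i == m then 0 else Imin p i)))).
    rewrite big_mkcond; apply: rsum_le => i _; case: eqP => [_|_] /=; first by rewrite /b; lra.
    by have := A_rate (i, true); have := A_rate (i, false); have := proj2 (L_rate i); rewrite /b /=; lra.
  right; rewrite /Rminus big_split /= rsum_const card_ord rsumN -big_distrr /=.
  by rewrite sum_except.
rewrite /leak_bound; set s := bigop _ _ _ in hs *; rewrite /b in hs.
clearbody s; lra.
Qed.

End Rates.

Lemma achievability (M : nat) (Y Z : 'I_M -> bool -> finType)
    (p : forall i a, (Y i a * Z i a)%type -> R) (hp : forall i a, is_pmf (@p i a))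
    (m0 : 'I_M) (hm0 : forall m, Imin p m <= Imin p m0) :
  achievable p (sumR (Imin p) - Imin p m0).
Proof.
move=> eps eps0.
have M1 : 1 <= INR M by rewrite -[1]/(INR 1); apply: le_INR; apply/leP; apply: leq_trans (ltn_ord m0).
(* Leakage budget per letter: [eps / 4] for [4 * INR M * delta], [eps / 4] for [eta * log_alphabet],
   and [eps / 2] for the constants, by taking [n] large. *)
pose delta := eps / (16 * INR M).
have delta0 : 0 < delta by apply: Rdiv_lt_0_compat; lra.
have lD : 0 <= log_alphabet Y Z.
  rewrite /log_alphabet -log2_1; apply: log2_le; first lra.
  have [x0 _] := pmf_inhabited (letter_pmf_pmf hp).
  rewrite -[1]/(INR 1); apply: le_INR; apply/leP/card_gt0P.
  by exists [ffun k => view (true, true) (x0 k)].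
(* The three bounds serve Fano's inequality, the error probability and the leakage budget; [1 +]
   keeps the denominator positive for a trivial alphabet. *)
pose eta := Rmin (1 / 2) (Rmin eps (eps / (4 * (1 + log_alphabet Y Z)))).
have eta1 : eta <= 1 / 2 by exact: Rmin_l.
have eta2 : eta <= eps by apply: Rle_trans (Rmin_r _ _) _; exact: Rmin_l.
have eta3 : eta * (1 + log_alphabet Y Z) <= eps / 4.
  apply: (@Rle_trans _ (eps / (4 * (1 + log_alphabet Y Z)) * (1 + log_alphabet Y Z))).
    apply: Rmult_le_compat_r; first lra.
    by apply: Rle_trans (Rmin_r _ _) _; exact: Rmin_r.
  by right; field; lra.
have eta0 : 0 < eta.
  by apply: Rmin_glb_lt; [lra|apply: Rmin_glb_lt; [lra|apply: Rdiv_lt_0_compat; lra]].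
have eta01 : 0 < eta < 1 by lra.
have M2 : 0 < INR (M * 2) by rewrite mult_INR /=; lra.
pose d := eta / INR (M * 2).
have d0 : 0 < d by exact: Rdiv_lt_0_compat.
have [n0 coding] := @fin_all_exists _ _ _ (fun k : 'I_M * bool =>
  pair_coding (hp k.1 k.2) (proj1 (proj2 (Imin_bounds hp k.1 k.2))) delta0 d0).
have [n1 n1P] := INR_unbounded ((4 * INR M + 2 + fano_bound eta) / (eps / 2)).
(* Exceeds the thresholds of all pairs at once, and is positive. *)
pose n := ((\sum_k n0 k) + n1).+1.
have n0n k : (n0 k <= n)%nat.
  by rewrite /n (bigD1 k) //= -addnA -addnS leq_addr.
have nR1 : 1 <= INR n by rewrite -[1]/(INR 1); apply: le_INR; apply/leP.
have nR : (4 * INR M + 2 + fano_bound eta) <= INR n * (eps / 2).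
  have n1n : INR n1 <= INR n by apply: le_INR; apply/leP; rewrite /n; lia.
  have -> : 4 * INR M + 2 + fano_bound eta =
    (4 * INR M + 2 + fano_bound eta) / (eps / 2) * (eps / 2) by field; lra.
  by apply: Rmult_le_compat_r; lra.
have [L LP] := @fin_all_exists _ _ _ (fun i : 'I_M =>
  exists_nat_log2 (Rmult_le_pos _ _ (pos_INR n) (proj1 (Imin_bounds hp i true)))).
have Apos (k : 'I_M * bool) :
    0 <= INR n * (entropy (@p k.1 k.2) (@snd _ _) - Imin p k.1 + 2 * delta).
  apply: Rmult_le_pos; first exact: pos_INR.
  by have [_ [_ h]] := Imin_bounds hp k.1 k.2; lra.
have [A AP] := @fin_all_exists _ _ _ (fun k => exists_nat_log2 (Apos k)).
have [f fP] := @fin_all_exists _ _ _ (fun k : 'I_M * bool =>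
  coding k n (n0n k) (A k) (L k.1) (proj1 (AP k)) (proj1 (LP k.1))
    (proj1 (proj2 (AP k))) (proj1 (proj2 (LP k.1)))).
have [g gP] := @fin_all_exists _ _ _ fP.
have [dec1 dec1P] := @fin_all_exists _ _ _ gP.
have [dec2 dec2P] := @fin_all_exists _ _ _ dec1P.
have f_lt k z : (f k z < A k)%nat by case: (dec2P k).
have g_lt k z : (g k z < L k.1)%nat by case: (dec2P k).
have L_gt0 i : (0 < L i)%nat by case: (LP i).
have bad : \rsum_(xs | ~~ good f g dec1 dec2 xs) src_pmf p xs <= eta.
  have -> : eta = INR (M * 2) * d by rewrite /d; field; lra.
  by apply: good_prob => // k; case: (dec2P k).
have L_rate i : INR n * Imin p i <= log2 (INR (L i)) <= INR n * Imin p i + 1 by case: (LP i).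
have A_rate k : log2 (INR (A k)) <=
    INR n * (entropy (@p k.1 k.2) (@snd _ _) - Imin p k.1 + 2 * delta) + 1.
  by case: (AP k) => _ [].
have leak m : leak_bound p m0 n A L m eta <= INR n * eps.
  apply: Rle_trans (leak_bound_le hm0 delta0 L_gt0 L_rate A_rate m eta) _.
  have -> : 4 * INR M * delta = eps / 4 by rewrite /delta; field; lra.
  have : INR n * (eta * log_alphabet Y Z + eps / 4) <= INR n * (eps / 2).
    by apply: Rmult_le_compat_l; lra.
  by lra.
have sec m := scheme_secrecy hp m0 L_gt0 f_lt g_lt m eta01 bad.
have [kr _] := key_rate m0 L_gt0 L_rate.
have nE x : INR n * x / INR n = x by field; lra.
exists n, M, #|msgT A L|, #|keyT m0 L|, (scheme m0 A L f g dec1).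
split=> //; split; first exact: scheme_valid.
have divle x y : x <= y -> x / INR n <= y / INR n.
  by move=> xy; apply: Rmult_le_compat_r => //; left; apply: Rinv_0_lt_compat; lra.
split; first exact: Rle_trans (scheme_error hp m0 L_gt0 f_lt g_lt bad) eta2.
have [_ low] := sec m0; have lk := leak m0.
split; [|split].
- apply: Rle_ge; rewrite -(nE (_ - eps)); apply: divle.
  by apply: Rle_trans low; lra.
- apply: Rle_ge; have -> : log2 (INR #|keyT m0 L|) / INR n - eps =
    (log2 (INR #|keyT m0 L|) - INR n * eps) / INR n by field; lra.
  by apply: divle; apply: Rle_trans low; lra.
- move=> m; rewrite -(nE eps); apply: divle.
  exact: Rle_trans (proj1 (sec m)) (leak m).
Qed.

Unset Implicit Arguments.

Theorem theorem1 (M : nat) (hM : (2 <= M)%nat)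
    (Y Z : 'I_M -> bool -> finType)
    (p : forall i a, (Y i a * Z i a)%type -> R)
    (hp : forall i a, is_pmf (p i a))
    (m0 : 'I_M) (hm0 : forall m : 'I_M, Imin p m <= Imin p m0) :
  is_private_key_capacity p (sumR (Imin p) - Imin p m0) /\
  (forall s : list R,
     Permutation s (map (Imin p) (enum 'I_M)) -> Sorted Rle s ->
     sumR (Imin p) - Imin p m0 = fold_right Rplus 0 (firstn (M - 1)%nat s)).
Proof.
split; last by move=> s; exact: sum_sorted_except_max.
split; first by move=> Rate; exact: converse.
by move=> b; apply; exact: achievability.
Qed.
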